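(* Consider $N$ Euler–Lagrange systems $$M_i(q_i)\ddot q_i+C_i(q_i,\dot q_i)\dot q_i+G_i(q_i)=\tau_i,\quad i=1,\dots,N,$$ with $q_i,\tau_i\in\mathbb{R}^n$, satisfying: (P1) $M_i(q_i)$ is symmetric and uniformly positive definite; (P2) for all $a',b\in\mathbb{R}^n$, $M_i(q_i)a'+C_i(q_i,\dot q_i)b+G_i(q_i)=Y_i(q_i,\dot q_i,a',b)\Theta_i$ with $Y_i$ a known regression matrix and $\Theta_i\in\mathbb{R}^p$ an unknown constant vector; (P3) $\dot M_i(q_i)-2C_i(q_i,\dot q_i)$ is skew-symmetric for all $q_i,\dot q_i$. Let $l$ be a positive integer, $m=2l$, $a=\begin{bmatrix}0&1\\-1&0\end{bmatrix}$, $S(z)=\mathrm{diag}(z)\otimes a$ for $z\in\mathbb{R}^l$, and let the leader be $\dot v=S(\omega)v$, $q_0=Cv$, where $v\in\mathbb{R}^m$, $C\in\mathbb{R}^{n\times m}$ is known, and $\omega=\mathrm{col}(\omega_{01},\dots,\omega_{0l})\in\mathbb{R}^l$ is an unknown vector with $\omega_{0k}>0$ for all $k$. Let $\bar{\mathcal G}$ be a digraph on nodes $\{0,1,\dots,N\}$ (node $0$ the leader, node $i$ the $i$-th Euler–Lagrange system) that contains a spanning tree rooted at node $0$, and such that the subgraph $\mathcal G$ on $\{1,\dots,N\}$ (obtained by removing all edges between node $0$ and the other nodes) is undirected; let $\bar{\mathcal N}_i=\{j:(j,i)\text{ is an edge of }\bar{\mathcal G}\}$. Consider the control law, for $i=1,\dots,N$,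 $$\tau_i=-K_is_i+Y_i\hat\Theta_i,\quad \dot{\hat\Theta}_i=-\Lambda_i^{-1}Y_i^Ts_i,$$ $$\dot\eta_i=S(\omega_i)\eta_i+\mu_1e_{vi},\quad \dot\omega_i=\mu_2\phi(e_{vi})\eta_i,\quad e_{vi}=\sum_{j\in\bar{\mathcal N}_i}(\eta_j-\eta_i),\ \eta_0=v,$$ where $\dot q_{ri}=CS(\omega_i)\eta_i-\alpha(q_i-C\eta_i)$, $s_i=\dot q_i-\dot q_{ri}$, $\ddot q_{ri}=CS(\omega_i)\dot\eta_i+CS(\dot\omega_i)\eta_i-\alpha(\dot q_i-C\dot\eta_i)$, $Y_i=Y_i(q_i,\dot q_i,\ddot q_{ri},\dot q_{ri})$ is the regression matrix from (P2) so that $Y_i\Theta_i=M_i(q_i)\ddot q_{ri}+C_i(q_i,\dot q_i)\dot q_{ri}+G_i(q_i)$, $\alpha>0$, $\mu_1,\mu_2>0$, $K_i$ are positive definite matrices, $\Lambda_i$ are diagonal matrices with positive diagonal entries, and for $x\in\mathbb{R}^m$, $\phi(x)\in\mathbb{R}^{l\times m}$ has $k$-th row with entry $-x_{2k}$ in column $2k-1$, $x_{2k-1}$ in column $2k$, and zeros elsewhere. Then for any initial conditions $q_i(0),\dot q_i(0),v(0),\eta_i(0),\omega_i(0),\hat\Theta_i(0)$, the closed-loop trajectories $q_i(t),\dot q_i(t),\eta_i(t),\omega_i(t),\hat\Theta_i(t)$ exist and are bounded for all $t\ge0$, and for $i=1,\dots,N$, $$\lim_{t\to\infty}(q_i(t)-q_0(t))=0,\qquad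 \lim_{t\to\infty}(\dot q_i(t)-\dot q_0(t))=0.$$
   Context: $\otimes$ is the Kronecker product; $\mathrm{col}(\cdot)$ stacks vectors into a column. The matrix $S(\omega)$ of the leader is skew-symmetric with all eigenvalues semi-simple and on the imaginary axis; the vector $\omega$ is not known to any follower and is not used by the control law.
   Formalization: Regularity left implicit is assumed: each M_i is differentiable and C_i, G_i, Y_i are jointly continuous in their arguments (for discontinuous G_i trajectories need not exist); the positive definite K_i are taken to be symmetric. *)

(* Defs.v *)
From HB Require Import structures.
From mathcomp Require Import all_boot all_order all_algebra.
From mathcomp Require Import all_classical all_reals all_analysis.
Set Implicit Arguments.
Unset Strict Implicit.
Unset Printing Implicit Defensive.
Import Order.TTheory GRing.Theory Num.Theory.
Import numFieldNormedType.Exports.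
Local Open Scope classical_set_scope.
Local Open Scope ring_scope.

(* Kronecker product A (x) B, with the standard (row-major) index convention:
   row index (i,k) of 'I_(m1*m2) is mxvec_index i k, i.e. i*m2 + k. *)
Definition kron (R : pzRingType) m1 n1 m2 n2 (A : 'M[R]_(m1, n1)) (B : 'M[R]_(m2, n2))
  : 'M[R]_(m1 * m2, n1 * n2) :=
  \matrix_(r, c) \sum_(i < m1) \sum_(k < m2) \sum_(j < n1) \sum_(h < n2)
     ((r == mxvec_index i k) && (c == mxvec_index j h))%:R * (A i j * B k h).

Definition i0_2 : 'I_2 := ord0.
Definition i1_2 : 'I_2 := ord_max.

Definition amat (R : pzRingType) : 'M[R]_2 :=
  \matrix_(i, j) (if (i == i0_2) && (j == i1_2) then 1
                  else if (i == i1_2) && (j == i0_2) then -1 else 0).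

Definition Smat (R : pzRingType) l (z : 'cV[R]_l) : 'M[R]_(l * 2) :=
  kron (diag_mx z^T) (amat R).

(* phi(x) in R^{l x m}: row k has -x_{2k} in column 2k-1, x_{2k-1} in column 2k
   (1-based); in 0-based Kronecker indexing, component 2k-1 (1-based) of x is
   x (mxvec_index k 0) and component 2k is x (mxvec_index k 1). *)
Definition phi (R : pzRingType) l (x : 'cV[R]_(l * 2)) : 'M[R]_(l, l * 2) :=
  \matrix_(k, c) ((c == mxvec_index k i0_2)%:R * - x (mxvec_index k i1_2) ord0
                 + (c == mxvec_index k i1_2)%:R * x (mxvec_index k i0_2) ord0).

(* A digraph on 'I_N.+1 is a relation E with  E j i  meaning (j,i) is an edge.
   It contains a spanning tree rooted at r: a sub-relation T of E in which the
   root has no incoming edge, every other node exactly one, and every node is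
   reachable from r along T. *)
Definition has_spanning_tree (N : nat) (E : rel 'I_N.+1) (r : 'I_N.+1) : Prop :=
  exists T : rel 'I_N.+1,
    (forall i j, T i j -> E i j) /\
    #|[set j | T j r]| = 0%N /\
    (forall i, i != r -> #|[set j | T j i]| = 1%N) /\
    (forall i, connect T r i).

Definition nodeval (X : Type) (N : nat) (v : X) (eta : 'I_N -> X) (j : 'I_N.+1) : X :=
  if unlift ord0 j is Some i then eta i else v.

Definition posdef (R : numDomainType) n (A : 'M[R]_n) : Prop :=
  A^T = A /\ forall x : 'cV[R]_n, x != 0 -> 0 < (x^T *m A *m x) ord0 ord0.

Definition bounded_pos (R : realType) a b (x : R -> 'M[R]_(a, b)) : Prop :=
  exists B : R, forall t, 0 <= t -> `|x t| <= B.

(* The closed-loop system (leader + N Euler-Lagrange followers + controller):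
   a solution on [0, +oo) is continuous from the right at 0 and satisfies the
   differential equations for every t > 0. *)
Definition closed_loop (R : realType) (N n p l : nat)
  (M : 'I_N -> 'cV[R]_n -> 'M[R]_n)
  (Cm : 'I_N -> 'cV[R]_n -> 'cV[R]_n -> 'M[R]_n)
  (G : 'I_N -> 'cV[R]_n -> 'cV[R]_n)
  (Y : 'I_N -> 'cV[R]_n -> 'cV[R]_n -> 'cV[R]_n -> 'cV[R]_n -> 'M[R]_(n, p))
  (Cout : 'M[R]_(n, l * 2)) (om0 : 'cV[R]_l) (E : rel 'I_N.+1)
  (alpha mu1 mu2 : R) (K : 'I_N -> 'M[R]_n) (Lam : 'I_N -> 'M[R]_p)
  (v : R -> 'cV[R]_(l * 2))
  (q qd : 'I_N -> R -> 'cV[R]_n)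
  (eta : 'I_N -> R -> 'cV[R]_(l * 2))
  (om : 'I_N -> R -> 'cV[R]_l)
  (th : 'I_N -> R -> 'cV[R]_p) : Prop :=
  (v t @[t --> 0^'+] --> v 0) /\
  (forall i, [/\ q i t @[t --> 0^'+] --> q i 0, qd i t @[t --> 0^'+] --> qd i 0,
     eta i t @[t --> 0^'+] --> eta i 0, om i t @[t --> 0^'+] --> om i 0
     & th i t @[t --> 0^'+] --> th i 0]) /\
  forall t : R, 0 < t ->
    is_derive t 1 v (Smat om0 *m v t) /\
    forall i : 'I_N,
      let ev := \sum_(j < N.+1 | E j (lift ord0 i))
                   (nodeval (v t) (fun k => eta k t) j - eta i t) in
      let etad := Smat (om i t) *m eta i t + mu1 *: ev in
      let omd := mu2 *: (phi ev *m eta i t) in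
      let qdr := Cout *m Smat (om i t) *m eta i t - alpha *: (q i t - Cout *m eta i t) in
      let s := qd i t - qdr in
      let qddr := Cout *m Smat (om i t) *m etad + Cout *m Smat omd *m eta i t
                  - alpha *: (qd i t - Cout *m etad) in
      let Yi := Y i (q i t) (qd i t) qddr qdr in
      let tau := - (K i *m s) + Yi *m th i t in
      [/\ is_derive t 1 (q i) (qd i t),
          (exists acc : 'cV[R]_n, is_derive t 1 (qd i) acc /\
             M i (q i t) *m acc + Cm i (q i t) (qd i t) *m qd i t + G i (q i t) = tau),
          is_derive t 1 (eta i) etad,
          is_derive t 1 (om i) omd
        & is_derive t 1 (th i) (- (invmx (Lam i) *m (Yi^T *m s)))].

(* Main.v *)
(** Combine the leader with the N followers in one autonomous system [x' = dynamics x], and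
    consider the sum of [|v|^2 / 2], of a multiple of the network energy (the Dirichlet energy
    of the node values [(v, eta)] plus [sum_i |om_i - om0|^2 / (2 mu2)]) and, for each agent,
    of [|q_i - C eta_i|^2 / 2] plus a multiple of its Slotine-Li energy.  The update laws of
    [om_i] and of the parameters cancel the indefinite terms, so that for suitable weights the
    derivative of this sum is at most
    [- sum_i (alpha / 2 |q_i - C eta_i|^2 + |s_i|^2 + |ev_i|^2)].
    Existence: [dynamics] is only continuous, so solutions come from Peano's theorem (an
    ultrafilter limit of Euler schemes) for a bounded field obtained by multiplying [dynamics] by
    a cut-off; this factor is nonnegative, hence only reparametrizes time, so the
    Lyapunov bound is unaffected and the cut-off is never active.
    Convergence: Barbalat's lemma gives [q_i - C eta_i], [s_i], [ev_i] -> 0; since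
    [sum_i ev_i . (eta_i - v)] is the opposite of the Dirichlet form at [(v, eta)],
    [eta_i - v -> 0] along the spanning tree, and Barbalat's lemma applied to [eta_i - v] gives
    [S(om_i) eta_i - S(om0) v -> 0].  Both limits follow, without [om_i -> om0]. *)

Require Import Defs.
From HB Require Import structures.
From mathcomp Require Import all_boot all_order all_algebra.
From mathcomp Require Import all_classical all_reals all_analysis.
From mathcomp Require Import ring lra.
Set Implicit Arguments.
Unset Strict Implicit.
Unset Printing Implicit Defensive.
Import Order.TTheory GRing.Theory Num.Theory.
Import numFieldNormedType.Exports.
Local Open Scope classical_set_scope.
Local Open Scope ring_scope.

(** * Norms and limits of matrices *)

Section norms.
Context {R : realType}.

Lemma ler_sum_term (I : finType) (f : I -> R) i : (forall j, 0 <= f j) -> f i <= \sum_j f j.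
Proof. by move=> f0; rewrite (bigD1 i)//= lerDl sumr_ge0. Qed.

Lemma mx_norm_leP m n (A : 'M[R]_(m, n)) (r : R) :
  `|A| <= r <-> 0 <= r /\ forall i j, `|A i j| <= r.
Proof.
rewrite [`|A|]/Num.Def.normr/= mx_normrE; split=> [Ar|[r0 Ar]].
  split; first by apply: le_trans Ar; exact: bigmax_ge_id.
  by move=> i j; apply: le_trans Ar; exact: (le_bigmax _ (fun ij => `|A ij.1 ij.2|) (i, j)).
by apply: bigmax_le => // -[i j] _; exact: Ar.
Qed.

Lemma ler_mx_entry m n (A : 'M[R]_(m, n)) i j : `|A i j| <= `|A|.
Proof. by have [_] := (mx_norm_leP A `|A|).1 (lexx _); apply. Qed.

Lemma norm_mulmx_le m n k (A : 'M[R]_(m, n)) (B : 'M[R]_(n, k)) :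
  `|A *m B| <= n%:R * (`|A| * `|B|).
Proof.
apply/mx_norm_leP; split=> [|i j]; first by rewrite !mulr_ge0.
rewrite mxE; apply: le_trans (ler_norm_sum _ _ _) _.
rewrite mulr_natl -[X in _ *+ X]card_ord -sumr_const; apply: ler_sum => h _.
by rewrite normrM ler_pM// ler_mx_entry.
Qed.

Lemma prod_norm_leE (V W : normedModType R) (x : V * W) (r : R) :
  (`|x| <= r) = (`|x.1| <= r) && (`|x.2| <= r).
Proof. by rewrite prod_normE ge_max. Qed.

End norms.

Section limits.
Context {R : realType} (T : Type) (F : set_system T) {FF : Filter F}.

Lemma cvg_pairP (V W : normedModType R) (f : T -> V * W) (l : V * W) :
  f x @[x --> F] --> l <->
  ((f x).1 @[x --> F] --> l.1) /\ ((f x).2 @[x --> F] --> l.2).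
Proof.
split=> [fl|[f1 f2]].
  split; first exact: (cvg_comp _ fst fl (@cvg_fst _ _ (nbhs l.1) (nbhs l.2) _)).
  exact: (cvg_comp _ snd fl (@cvg_snd _ _ (nbhs l.1) (nbhs l.2) _)).
rewrite (_ : f = fun x => ((f x).1, (f x).2)); first by case: l f1 f2 => *; exact: cvg_pair.
by apply/funext => x; case: (f x).
Qed.

Lemma cvg_mxP m n (A : T -> 'M[R]_(m, n)) (l : 'M[R]_(m, n)) :
  A x @[x --> F] --> l <-> forall i j, A x i j @[x --> F] --> l i j.
Proof.
split=> [Al i j|Al].
  exact: (cvg_comp A (fun M : 'M[R]_(m, n) => M i j) Al (@coord_continuous R m n i j l)).
apply/cvgrPdist_le => e e0.
have : \forall x \near F, forall ij : 'I_m * 'I_n, `|l ij.1 ij.2 - A x ij.1 ij.2| <= e.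
  by apply: filter_forall => -[i j]; exact: ((cvgrPdist_le _ _).1 (Al i j)).
apply: filterS => x dist_le; apply/mx_norm_leP; split; first exact: ltW.
by move=> i j; rewrite !mxE; exact: (dist_le (i, j)).
Qed.

Lemma cvg_sum (I : finType) (P : pred I) (V : normedModType R) (f : I -> T -> V) (l : I -> V) :
  (forall i, f i x @[x --> F] --> l i) ->
  \sum_(i | P i) f i x @[x --> F] --> \sum_(i | P i) l i.
Proof. by move=> fl; apply: (cvg_big (op := +%R)) => //; exact: add_continuous. Qed.

Lemma cvg_prod (I : finType) (P : pred I) (f : I -> T -> R) (l : I -> R) :
  (forall i, f i x @[x --> F] --> l i) ->
  \prod_(i | P i) f i x @[x --> F] --> \prod_(i | P i) l i.
Proof. by move=> fl; apply: (@cvg_big R I *%R 1 P) => //; exact: (@mul_continuous R). Qed.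

Lemma cvg_scaler_cst (V : normedModType R) (k : R) (f : T -> V) (l : V) :
  f x @[x --> F] --> l -> k *: f x @[x --> F] --> k *: l.
Proof. by move=> fl; apply: cvgZ => //; exact: cvg_cst. Qed.

Lemma cvg_mulmx m n k (A : T -> 'M[R]_(m, n)) (B : T -> 'M[R]_(n, k))
    (a : 'M[R]_(m, n)) (b : 'M[R]_(n, k)) :
  A x @[x --> F] --> a -> B x @[x --> F] --> b -> A x *m B x @[x --> F] --> a *m b.
Proof.
move=> /cvg_mxP Aa /cvg_mxP Bb; apply/cvg_mxP => i j.
under eq_fun do rewrite mxE; rewrite mxE.
by apply: cvg_sum => h; apply: cvgM; [exact: Aa|exact: Bb].
Qed.

Lemma cvg_mulmxr m n k (A : 'M[R]_(m, n)) (B : T -> 'M[R]_(n, k))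
    (b : 'M[R]_(n, k)) :
  B x @[x --> F] --> b -> A *m B x @[x --> F] --> A *m b.
Proof. by move=> Bb; apply: cvg_mulmx => //; exact: cvg_cst. Qed.

Lemma cvg_colP m n (A : T -> 'M[R]_(m, n)) (a : 'M[R]_(m, n)) :
  A x @[x --> F] --> a <-> forall j, col j (A x) @[x --> F] --> col j a.
Proof.
split=> [/cvg_mxP Aa j|Aa]; apply/cvg_mxP => i k.
  by under eq_fun do rewrite mxE; rewrite mxE; exact: Aa.
have /cvg_mxP/(_ i ord0) := Aa k; rewrite mxE.
by under eq_fun do rewrite mxE.
Qed.

Lemma cvg_trmx m n (A : T -> 'M[R]_(m, n)) (a : 'M[R]_(m, n)) :
  A x @[x --> F] --> a -> (A x)^T @[x --> F] --> a^T.
Proof.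
move=> /cvg_mxP Aa; apply/cvg_mxP => i j.
by under eq_fun do rewrite mxE; rewrite mxE; exact: Aa.
Qed.

Lemma cvg_det n (A : T -> 'M[R]_n) (a : 'M[R]_n) :
  A x @[x --> F] --> a -> \det (A x) @[x --> F] --> \det a.
Proof.
move=> /cvg_mxP Aa; apply: cvg_sum => s; apply: cvgM; first exact: cvg_cst.
by apply: cvg_prod => i; exact: Aa.
Qed.

Lemma cvg_adjugate n (A : T -> 'M[R]_n) (a : 'M[R]_n) :
  A x @[x --> F] --> a -> \adj (A x) @[x --> F] --> \adj a.
Proof.
move=> /cvg_mxP Aa; apply/cvg_mxP => i j; under eq_fun do rewrite mxE; rewrite mxE.
apply: cvgM; first exact: cvg_cst.
apply: cvg_det; apply/cvg_mxP => i' j'; under eq_fun do rewrite !mxE; rewrite !mxE.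
exact: Aa.
Qed.

Lemma cvg_invmx n (A : T -> 'M[R]_n) (a : 'M[R]_n) : (forall x, A x \in unitmx) -> a \in unitmx ->
  A x @[x --> F] --> a -> invmx (A x) @[x --> F] --> invmx a.
Proof.
move=> Au au Aa; rewrite /invmx au; under eq_fun do rewrite Au.
apply: cvgZ; last exact: cvg_adjugate.
by apply: cvgV; [rewrite -unitfE -unitmxE|exact: cvg_det].
Qed.

End limits.

Section bounded_functions.
Context {R : realType} {T : Type} (A : set T).
Implicit Types (V W : normedModType R).

Definition bounded_on V (f : T -> V) := exists B : R, forall x, A x -> `|f x| <= B.

Lemma eq_bounded_on V (f g : T -> V) : f =1 g -> bounded_on f -> bounded_on g.
Proof. by move=> /funext->. Qed.

Lemma bounded_on_cst V (a : V) : bounded_on (fun=> a).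
Proof. by exists `|a|. Qed.

Lemma bounded_onD V (f g : T -> V) :
  bounded_on f -> bounded_on g -> bounded_on (fun x => f x + g x).
Proof.
by move=> [B fB] [C gC]; exists (B + C) => x Ax; rewrite (le_trans (ler_normD _ _))// lerD ?fB ?gC.
Qed.

Lemma bounded_onN V (f : T -> V) : bounded_on f -> bounded_on (fun x => - f x).
Proof. by move=> [B fB]; exists B => x Ax; rewrite normrN fB. Qed.

Lemma bounded_onB V (f g : T -> V) :
  bounded_on f -> bounded_on g -> bounded_on (fun x => f x - g x).
Proof. by move=> fb gb; apply: bounded_onD => //; exact: bounded_onN. Qed.

Lemma bounded_onBr V (f : T -> V) (a : V) : bounded_on (fun x => f x - a) -> bounded_on f.
Proof.
move=> /bounded_onD/(_ (bounded_on_cst a)); apply: eq_bounded_on => x.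
by rewrite subrK.
Qed.

Lemma bounded_onZ V (k : R) (f : T -> V) : bounded_on f -> bounded_on (fun x => k *: f x).
Proof. by move=> [B fB]; exists (`|k| * B) => x Ax; rewrite normrZ ler_wpM2l ?fB. Qed.

Lemma bounded_on_mulmx m n k (f : T -> 'M[R]_(m, n)) (g : T -> 'M[R]_(n, k)) :
  bounded_on f -> bounded_on g -> bounded_on (fun x => f x *m g x).
Proof.
move=> [B fB] [C gC]; exists (n%:R * (B * C)) => x Ax.
by rewrite (le_trans (norm_mulmx_le _ _))// ler_wpM2l// ler_pM ?fB ?gC.
Qed.

Lemma bounded_on_pairP V W (f : T -> V * W) :
  bounded_on f <-> bounded_on (fun x => (f x).1) /\ bounded_on (fun x => (f x).2).
Proof.
split=> [[B fB]|[[B fB] [C gC]]].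
  by split; exists B => x /fB; rewrite prod_norm_leE => /andP[].
exists (Num.max B C) => x Ax; rewrite prod_norm_leE.
by rewrite (le_trans (fB x Ax)) ?(le_trans (gC x Ax)) ?le_max ?lexx ?orbT.
Qed.

Lemma bounded_on_colP m n (f : T -> 'M[R]_(m, n)) :
  bounded_on f <-> forall j, bounded_on (fun x => col j (f x)).
Proof.
split=> [[B fB] j|/choice[B fB]].
  exists B => x /fB; apply: le_trans; apply/mx_norm_leP; split=> // i k.
  by rewrite mxE ler_mx_entry.
exists (\sum_j `|B j|) => x Ax; apply/mx_norm_leP; split=> [|i j]; first exact: sumr_ge0.
have -> : f x i j = col j (f x) i ord0 by rewrite mxE.
apply: le_trans (ler_mx_entry _ _ _) _; apply: le_trans (fB j x Ax) _.
by apply: le_trans (ler_norm _) _; exact: (@ler_sum_term _ _ (fun j => `|B j|)).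
Qed.

End bounded_functions.

Lemma continuous_mx {R : realType} (T : topologicalType) m n (A : T -> 'M[R]_(m, n)) :
  (forall i j, continuous (fun x => A x i j)) -> continuous A.
Proof. by move=> Acont x; apply/cvg_mxP => i j; exact: Acont. Qed.

(** * Derivatives of curves *)

Section curve_derivatives.
Context {R : realType}.
Implicit Types (t : R).

Lemma is_deriveP (V W : normedModType R) (f : V -> W) a v l :
  is_derive a v f l <-> h^-1 *: (f (h *: v + a) - f a) @[h --> 0^'] --> l.
Proof.
split=> [[df <-//]|fl]; apply: DeriveDef; first by apply/cvg_ex; exists l.
exact: cvg_lim fl.
Qed.

Lemma is_derive_mxP m n (A : R -> 'M[R]_(m, n)) t dA :
  is_derive t 1 A dA <-> forall i j, is_derive t 1 (fun s => A s i j) (dA i j).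
Proof.
have entryE i j :
    (fun h => (h^-1 *: (A (h *: 1 + t) - A t)) i j) =
    (fun h => h^-1 *: (A (h *: 1 + t) i j - A t i j)).
  by apply/funext => h; rewrite !mxE.
split=> [/is_deriveP/cvg_mxP dAt i j|dAt]; apply/is_deriveP; first by rewrite -entryE.
by apply/cvg_mxP => i j; rewrite entryE; exact/is_deriveP.
Qed.

Lemma is_derive_colP m n (A : R -> 'M[R]_(m, n)) t dA :
  is_derive t 1 A dA <-> forall j, is_derive t 1 (fun s => col j (A s)) (col j dA).
Proof.
have entryE i j k : (fun s => col j (A s) i k) = (fun s => A s i j).
  by apply/funext => s; rewrite mxE.
split=> [/is_derive_mxP AP j|AP]; apply/is_derive_mxP => i k.
  by rewrite entryE mxE.
by have /is_derive_mxP/(_ i ord0) := AP k; rewrite entryE mxE.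
Qed.

Lemma is_derive_pairP (V W : normedModType R) (f : R -> V * W) t df :
  is_derive t 1 f df <->
  is_derive t 1 (fun s => (f s).1) df.1 /\ is_derive t 1 (fun s => (f s).2) df.2.
Proof.
split=> [/is_deriveP/cvg_pairP[df1 df2]|[/is_deriveP df1 /is_deriveP df2]].
  by split; exact/is_deriveP.
by apply/is_deriveP/cvg_pairP; split.
Qed.

Lemma is_derive_continuous (V : normedModType R) (f : R -> V) t df :
  is_derive t 1 f df -> {for t, continuous f}.
Proof. by move=> [/derivable1_diffP/differentiable_continuous]. Qed.

Lemma is_derive_diff_comp (V W : normedModType R) (g : V -> W) (f : R -> V) t df :
  differentiable g (f t) -> is_derive t 1 f df ->
  is_derive t 1 (fun s => g (f s)) ('d g (f t) df).
Proof.
move=> dg [/derivable1_diffP dft <-].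
have dgf : differentiable (g \o f) t by exact: differentiable_comp.
apply: DeriveDef; first exact/derivable1_diffP.
by rewrite (deriveE _ dgf) diff_comp//= (deriveE _ dft).
Qed.

End curve_derivatives.

(** * Spaces with compact balls *)

Section proper_spaces.
Context {R : realType}.

Definition proper_space (V : normedModType R) :=
  forall r : R, compact [set x : V | `|x| <= r].

Lemma proper_space_mx m n : proper_space 'M[R]_(m, n).
Proof.
move=> r.
have -> : [set x : 'M[R]_(m, n) | `|x| <= r] =
    vec_mx @` [set x : 'rV[R]_(m * n) | `|x| <= r].
  apply/seteqP; split=> [A /= /mx_norm_leP[r0 Ar]|_ /= [u /mx_norm_leP[r0 ur] <-]].
    exists (mxvec A); last exact: mxvecK.
    by apply/mx_norm_leP; split=> // i /mxvec_indexP[j k]; rewrite (ord1 i) mxvecE.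
  by apply/mx_norm_leP; split=> // i j; rewrite mxE.
apply: continuous_compact.
  apply: continuous_subspaceT; apply: continuous_mx => i j.
  by under eq_fun do rewrite mxE; exact: coord_continuous.
apply: bounded_closed_compact.
  by exists r; split=> [|s rs u /= ur]; [exact: num_real|apply: le_trans ur (ltW rs)].
rewrite (_ : mkset _ = Num.Def.normr @^-1` [set s : R | s <= r])//.
by apply: closed_comp; [move=> x _; exact: norm_continuous|exact: closed_le].
Qed.

Lemma proper_space_prod (V W : normedModType R) :
  proper_space V -> proper_space W -> proper_space (V * W)%type.
Proof.
move=> Vproper Wproper r.
rewrite (_ : mkset _ = [set x : V | `|x| <= r] `*` [set x : W | `|x| <= r]).
  exact: compact_setX.
by apply/seteqP; split=> x; rewrite /= prod_norm_leE => /andP.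
Qed.

Lemma continuous_ball_bounded (V W : normedModType R) (f : V -> W) (r : R) :
  proper_space V -> continuous f -> bounded_on [set x | `|x| <= r] f.
Proof.
move=> Vproper fcont; have [r0|r0] := ltP r 0.
  by exists 0 => x /= xr; have := le_lt_trans xr r0; rewrite ltNge normr_ge0.
have [|||c _ cmax] := @compact_EVT_max _ _ (fun x => `|f x|) [set x : V | `|x| <= r].
- by exists 0; rewrite /= normr0.
- exact: Vproper.
- by apply: continuous_subspaceT => x; apply: cvg_norm; exact: fcont.
by exists `|f c| => x xr; apply: cmax; rewrite inE.
Qed.

Lemma continuous_ball_unif_continuous (V W : normedModType R) (f : V -> W) (r e : R) :
  proper_space V -> continuous f -> 0 < e ->
  exists2 d : R, 0 < d & forall x y, `|x| <= r -> `|x - y| < d -> `|f x - f y| < e.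
Proof.
move=> Vproper fcont e0.
have := (compact_near_coveringP [set x : V | `|x| <= r]).1 (Vproper r).
move=> /(_ R 0^'+ (fun d x => forall y, `|x - y| < d -> `|f x - f y| < e)).
case=> [x xr|d d0 dcover]; last first.
  exists (d / 2); first by rewrite divr_gt0.
  have d2d : d / 2 < d by rewrite ltr_pdivrMr// ltr_pMr// ltr1n.
  move=> x y xr xy; apply: (dcover (d / 2)) => //=; last by rewrite divr_gt0.
  by rewrite sub0r normrN gtr0_norm ?divr_gt0.
have /cvgrPdist_lt/(_ (e / 2)) := fcont x; rewrite divr_gt0// => /(_ isT).
move=> /nbhs_ballP[s /= s0]; rewrite -ball_normE/= => near_fx.
near_simpl; near=> z d => y zy.
have xz : `|x - z| < s / 2.
  by near: z; apply/nbhs_ballP; exists (s / 2); rewrite /= ?divr_gt0// => z;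
    rewrite -ball_normE.
have ds : d < s / 2 by near: d; apply: nbhs_right_lt; rewrite divr_gt0.
have xy : `|x - y| < s.
  rewrite -(subrKA z) (le_lt_trans (ler_normD _ _))// (splitr s) ltrD//.
  exact: lt_trans ds.
have xzs : `|x - z| < s by apply: lt_trans xz _; rewrite ltr_pdivrMr// ltr_pMr// ltr1n.
rewrite -(subrKA (f x)) (le_lt_trans (ler_normD _ _))// (splitr e) ltrD//.
  by rewrite distrC; exact: near_fx.
exact: near_fx.
Unshelve. all: by end_near. Qed.

End proper_spaces.

(** * Mean value inequality and Barbalat's lemma *)

Section mean_value_inequality.
Context {R : realType} {V : normedModType R}.
Implicit Types (x dx : R -> V) (a b s t K L : R).

Lemma is_derive_right_lipschitz x t K d :
  is_derive t 1 x d -> `|d| < K -> \forall s \near t^'+, `|x s - x t| <= K * (s - t).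
Proof.
move=> /is_deriveP/cvgr_norm_lt/[apply]/nbhs_ballP[r /= r0 slope_lt].
near=> s; have ts : 0 < s - t by rewrite subr_gt0.
have := slope_lt (s - t); rewrite /= -ball_normE/= sub0r normrN gtr0_norm//.
rewrite ltrBlDr addrC => /(_ _ (lt0r_neq0 ts)).
rewrite [_ *: 1]mulr1 subrK normrZ gtr0_norm ?invr_gt0// ltr_pdivrMl// mulrC => slope.
by apply/ltW/slope; near: s; apply: nbhs_right_lt; rewrite ltrDl.
Unshelve. all: by end_near. Qed.

(* For [K > L], the function [s |-> |x s - x a| - K (s - a)] can only attain its minimum
   over [a, b] at [b]. *)
Lemma is_derive_lipschitz x dx a b L :
  a <= b -> (forall t, a <= t <= b -> is_derive t 1 x (dx t)) ->
  (forall t, a <= t <= b -> `|dx t| <= L) -> `|x b - x a| <= L * (b - a).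
Proof.
rewrite le_eqVlt => /predU1P[-> _ _|ab dxP dxL]; first by rewrite !subrr normr0 mulr0.
rewrite -ler_pdivrMr ?subr_gt0//; apply/ler_addgt0Pr => e e0; rewrite ler_pdivrMr ?subr_gt0//.
pose K := L + e.
pose g t := `|x t - x a| - K * (t - a).
have [|c] := @EVT_min R g a b (ltW ab).
  apply: continuous_in_subspaceT => t; rewrite inE/= in_itv/= => tab.
  apply: cvgB; last by apply: cvgM; [exact: cvg_cst|apply: cvgB; [exact: cvg_id|exact: cvg_cst]].
  apply: cvg_norm; apply: cvgB; last exact: cvg_cst.
  exact: is_derive_continuous (dxP t tab).
rewrite in_itv/= => /andP[ac cb] g_min; have acb : a <= c <= b by rewrite ac.
have [cltb|bc] := ltP c b; last first.
  have := g_min a; rewrite in_itv/= lexx (ltW ab) (le_anti (introT andP (conj cb bc))).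
  by rewrite /g !subrr normr0 mulr0 subr0 subr_le0; apply.
pose K' := L + e / 2.
have dK' : `|dx c| < K' by rewrite (le_lt_trans (dxL c acb))// /K'; lra.
near c^'+ => s.
have cs : c < s by [].
have sb : s <= b by near: s; exact: nbhs_right_le.
have x_cs : `|x s - x c| <= K' * (s - c).
  by near: s; exact: is_derive_right_lipschitz (dxP c acb) dK'.
have := g_min s; rewrite in_itv/= sb (le_trans ac (ltW cs)) => /(_ isT).
have : `|x s - x a| <= `|x s - x c| + `|x c - x a|.
  by rewrite (le_trans _ (ler_normD _ _))// addrA subrK.
by rewrite /g /K /K' in x_cs *; nra.
Unshelve. all: by end_near. Qed.

End mean_value_inequality.

Section trajectories.
Context {R : realType}.
Implicit Types (V W : normedModType R).

Definition trajectory V (x dx : R -> V) :=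
  (x t @[t --> 0^'+] --> x 0) /\ forall t : R, 0 < t -> is_derive t 1 x (dx t).

Lemma trajectory_mxP m n (x dx : R -> 'M[R]_(m, n)) :
  trajectory x dx <-> forall i j, trajectory (fun t => x t i j) (fun t => dx t i j).
Proof.
split=> [[x0 dxP] i j|xt].
  split=> [|t t0]; first by move/cvg_mxP : x0; exact.
  by move/is_derive_mxP : (dxP t t0); exact.
split=> [|t t0]; first by apply/cvg_mxP => i j; exact: (xt i j).1.
by apply/is_derive_mxP => i j; exact: (xt i j).2.
Qed.

Lemma trajectory_lipschitz V (x dx : R -> V) (a b L : R) :
  trajectory x dx -> (forall t : R, 0 < t -> `|dx t| <= L) ->
  0 <= a -> a <= b -> `|x b - x a| <= L * (b - a).
Proof.
move=> [x0 dxP] dxL a0 ab.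
have lip_gt0 s : 0 < s -> s <= b -> `|x b - x s| <= L * (b - s).
  move=> s0 sb; apply: is_derive_lipschitz sb _ _ => t /andP[st _].
    exact/dxP/(lt_le_trans s0).
  exact/dxL/(lt_le_trans s0).
move: a0 ab; rewrite le_eqVlt => /predU1P[<-|a0]; last exact: lip_gt0.
rewrite le_eqVlt => /predU1P[<-|b0]; first by rewrite !subrr normr0 mulr0.
have normB_cvg : `|x b - x s| @[s --> 0^'+] --> `|x b - x 0|.
  by apply: cvg_norm; apply: cvgB => //; exact: cvg_cst.
have bound_cvg : L * (b - s) @[s --> (0 : R)^'+] --> L * (b - 0).
  apply: cvgM; first exact: cvg_cst.
  by apply: cvgB; [exact: cvg_cst|apply: cvg_at_right_filter; exact: cvg_id].
apply: ler_cvg_to normB_cvg bound_cvg _; near=> s.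
by apply: lip_gt0 => //; near: s; exact: nbhs_right_le.
Unshelve. all: by end_near. Qed.

Lemma trajectory_MVT (f df : R -> R) (a b : R) : trajectory f df -> 0 <= a -> a < b ->
  exists2 c, a < c < b & f b - f a = df c * (b - a).
Proof.
move=> [f0 dfP] a0 ab; have fcont t : 0 < t -> {for t, continuous f}.
  by move=> t0; exact: is_derive_continuous (dfP t t0).
have [|||c] := @MVT R f df a b => //.
- by move=> c; rewrite in_itv/= => /andP[ac _]; apply: dfP; exact: le_lt_trans ac.
- apply/continuous_within_itvP => //; split.
  + by move=> c; rewrite in_itv/= => /andP[ac _]; apply: fcont; exact: le_lt_trans ac.
  + move: a0; rewrite le_eqVlt => /predU1P[<-//|a0].
    exact/cvg_at_right_filter/fcont.
  + by apply/cvg_at_left_filter/fcont; exact: le_lt_trans ab.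
- by rewrite in_itv/= => cab ->; exists c.
Qed.

Lemma trajectory_nonincreasing (f df : R -> R) (a b : R) : trajectory f df ->
  (forall t : R, 0 < t -> df t <= 0) -> 0 <= a -> a <= b -> f b <= f a.
Proof.
move=> ft df_le0 a0; rewrite le_eqVlt => /predU1P[->//|ab].
have [c /andP[ac _] fbaE] := trajectory_MVT ft a0 ab.
rewrite -subr_le0 fbaE mulr_le0_ge0//; last by rewrite subr_ge0 ltW.
by apply: df_le0; exact: le_lt_trans ac.
Qed.

Lemma nonincreasing_bounded_cvg (f : R -> R) (B : R) :
  (forall a b : R, 0 <= a -> a <= b -> f b <= f a) -> (forall t : R, 0 <= t -> B <= f t) ->
  exists l : R, f t @[t --> +oo] --> l.
Proof.
move=> f_nincr fB; pose g (t : R) := - f (Num.max 0 t).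
have g_cvg : g t @[t --> +oo] --> sup (range g).
  apply: nondecreasing_cvgr => [s t st|].
    rewrite lerN2; apply: f_nincr; first by rewrite le_max lexx.
    by rewrite ge_max !le_max lexx st orbT.
  by exists (- B) => _ [t _ <-]; rewrite lerN2 fB// le_max lexx.
exists (- sup (range g)); apply: cvg_trans (cvgN g_cvg).
by apply: near_eq_cvg; near=> t; rewrite /g/= opprK max_r.
Unshelve. all: by end_near. Qed.

Definition unif_continuous_gt0 (f : R -> R) :=
  forall e : R, 0 < e -> exists2 d : R, 0 < d &
    forall s t : R, 0 < s -> 0 < t -> `|s - t| < d -> `|f s - f t| < e.

Lemma barbalat (f df : R -> R) (l : R) :
  trajectory f df -> f t @[t --> +oo] --> l -> unif_continuous_gt0 df ->
  df t @[t --> +oo] --> 0.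
Proof.
move=> ft fl df_unif; apply/cvgr0Pnorm_le => e e0.
have e2 : 0 < e / 2 by rewrite divr_gt0.
have [d d0 df_near] := df_unif _ e2.
have d2 : 0 < d / 2 by rewrite divr_gt0.
have tol_gt0 : 0 < e / 2 * (d / 2) / 2 by rewrite divr_gt0// mulr_gt0.
have /cvgrPdist_lt/(_ _ tol_gt0)[T [_ fT]] := fl.
near=> t; have t0 : 0 < t by [].
have Tt : T < t by near: t; apply: nbhs_pinfty_gt; exact: num_real.
have [|c /andP[tc ct] fE] := trajectory_MVT ft (ltW t0) (_ : t < t + d / 2).
  by rewrite ltrDl.
have df_c : `|df c| < e / 2.
  have {}fE : df c * (d / 2) = f (t + d / 2) - f t by rewrite fE [t + _ - t]addrAC subrr add0r.
  rewrite -(ltr_pM2r d2) -{1}(gtr0_norm d2) -normrM fE -(subrKA l).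
  rewrite (splitr (e / 2 * _)) (le_lt_trans (ler_normD _ _))// ltrD//.
    by rewrite distrC fT// (lt_trans Tt)// ltrDl.
  exact: fT.
rewrite -(subrK (df c) (df t)) (le_trans (ler_normD _ _))// (splitr e) lerD ?(ltW df_c)//.
apply/ltW/df_near => //; first exact: lt_trans tc.
by rewrite ltr_norml; apply/andP; split; lra.
Unshelve. all: by end_near. Qed.

End trajectories.

(** * Peano's theorem *)

Lemma fmap_ultra_filter (T U : Type) (f : T -> U) (F : set_system T) :
  UltraFilter F -> UltraFilter (f @ F).
Proof.
move=> FU; split; first exact: fmap_proper_filter.
move=> G GF sFG; apply/seteqP; split=> // A GA.
have [//|FnA] := in_ultra_setVsetC (f @^-1` A) FU.
have GnA : G (~` A) by exact: sFG.
by have [x []] := filter_ex (filterI GA GnA).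
Qed.

Section peano.
Context {R : realType} (V : normedModType R) (f : V -> V) (L : R) (x0 : V).
Hypothesis Vproper : proper_space V.
Hypothesis fcont : continuous f.
Hypothesis fL : forall x, `|f x| <= L.

Let L_ge0 : 0 <= L. Proof. exact: le_trans (fL 0). Qed.

Definition euler (h : R) (k : nat) : V := iter k (fun y => y + h *: f y) x0.

Lemma euler_near (h e : R) (c : V) a k : 0 <= h ->
  (forall j, (j < k)%N -> `|f (euler h (a + j)) - c| <= e) ->
  `|euler h (a + k) - euler h a - (k%:R * h) *: c| <= k%:R * h * e.
Proof.
move=> h0; elim: k => [|k IHk] f_near.
  by rewrite addn0 subrr mul0r scale0r subrr normr0 mul0r.
have -> : euler h (a + k.+1) - euler h a - (k.+1%:R * h) *: c =
    (euler h (a + k) - euler h a - (k%:R * h) *: c) + h *: (f (euler h (a + k)) - c).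
  rewrite addnS /= -natr1 mulrDl mul1r scalerDl scalerBr opprD !addrA.
  by congr (_ - _); rewrite -!addrA; congr (_ + _); rewrite addrC -addrA.
rewrite -natr1 mulrDl mul1r mulrDl (le_trans (ler_normD _ _))// lerD//.
  by apply: IHk => j jk; apply: f_near; exact: ltnW.
by rewrite normrZ ger0_norm// ler_wpM2l// f_near.
Qed.

Lemma euler_lipschitz (h : R) a k : 0 <= h -> `|euler h (a + k) - euler h a| <= k%:R * h * L.
Proof.
move=> h0; have := @euler_near h L 0 a k h0; rewrite scaler0 subr0; apply.
by move=> j _; rewrite subr0.
Qed.

Definition euler_path (h t : R) : V := euler h (Num.truncn (t / h)).

Lemma euler_path0 h : euler_path h 0 = x0.
Proof. by rewrite /euler_path mul0r truncn0. Qed.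

Lemma truncn_div_dist (h s t : R) : 0 < h -> 0 <= s -> s <= t ->
  `|(Num.truncn (t / h) - Num.truncn (s / h))%:R * h - (t - s)| <= h.
Proof.
move=> h0 s0 st.
have truncn_div (u : R) : 0 <= u ->
    (Num.truncn (u / h))%:R * h <= u < (Num.truncn (u / h)).+1%:R * h.
  move=> u0; have /andP[uge ult] := truncn_itv (divr_ge0 u0 (ltW h0)).
  by rewrite -ler_pdivlMr// uge -ltr_pdivrMr.
have := truncn_div s s0; have := truncn_div t (le_trans s0 st).
rewrite natrB ?le_truncn ?ler_pM2r ?invr_gt0// mulrBl -!natr1 !mulrDl !mul1r.
by move=> /andP[t1 t2] /andP[s1 s2]; rewrite ler_norml; apply/andP; split; lra.
Qed.

Lemma euler_path_near (h s t : R) (y c : V) (r e : R) : 0 < h -> 0 <= s -> s <= t ->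
  (forall z : V, `|z - y| <= r -> `|f z - c| <= e) ->
  `|euler_path h s - y| + (t - s + h) * L <= r ->
  `|euler_path h t - euler_path h s - (t - s) *: c| <= (t - s + h) * e + h * `|c|.
Proof.
move=> h0 s0 st f_near path_near; have h_ge0 := ltW h0.
have k_dist := truncn_div_dist h0 s0 st.
set a := Num.truncn (s / h) in k_dist; set k := (_ - a)%N in k_dist.
have kh_le : k%:R * h <= t - s + h.
  by move: k_dist; rewrite ler_norml => /andP[_]; rewrite lerBlDr addrC.
have pathE : euler_path h t = euler h (a + k).
  by rewrite subnKC// le_truncn// ler_pM2r// invr_gt0.
have r0 : 0 <= r.
  by apply: le_trans path_near; rewrite addr_ge0// mulr_ge0// addr_ge0 ?subr_ge0.
have e0 : 0 <= e by apply: le_trans (f_near y _); rewrite ?subrr ?normr0.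
have -> : euler_path h t - euler_path h s - (t - s) *: c =
    (euler_path h t - euler_path h s - (k%:R * h) *: c) + (k%:R * h - (t - s)) *: c.
  by rewrite (scalerBl (k%:R * h)) addrA subrK.
rewrite (le_trans (ler_normD _ _))// lerD//; last by rewrite normrZ ler_wpM2r.
apply: le_trans (_ : k%:R * h * e <= _); last exact: ler_wpM2r.
rewrite pathE; apply: euler_near => // j jk; apply: f_near.
rewrite -(subrKA (euler_path h s)) (le_trans (ler_normD _ _))// addrC.
apply: le_trans path_near; rewrite lerD2l; apply: le_trans (euler_lipschitz _ _ h_ge0) _.
by rewrite ler_wpM2r//; apply: le_trans kh_le; rewrite ler_wpM2r// ler_nat ltnW.
Qed.

Lemma euler_path_lipschitz (h s t : R) : 0 < h -> 0 <= s -> s <= t ->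
  `|euler_path h t - euler_path h s| <= (t - s + h) * L.
Proof.
move=> h0 s0 st.
have := @euler_path_near h s t (euler_path h s) 0 _ L h0 s0 st _ (lexx _).
by rewrite scaler0 subr0 normr0 mulr0 addr0; apply => z _; rewrite subr0.
Qed.

(* The bounds of [euler_path_near] in the limit [h -> 0]. *)
Definition euler_limit (x : R -> V) := forall (s t : R) (y c : V) (r e : R),
  0 <= s -> s <= t -> (forall z : V, `|z - y| <= r -> `|f z - c| <= e) ->
  `|x s - y| + (t - s) * L < r -> `|x t - x s - (t - s) *: c| <= (t - s) * e.

Lemma euler_path_ultra_cvg (U : set_system nat) (t : R) : UltraFilter U -> 0 <= t ->
  exists y : V, euler_path (harmonic n) t @[n --> U] --> y.
Proof.
move=> UU t0; have := @Vproper (`|x0| + (t + 1) * L); rewrite compact_ultra.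
move=> /(_ _ (fmap_ultra_filter (fun n => euler_path (harmonic n) t) UU)).
case=> [|y [_ ycvg]]; last by exists y.
near_simpl; apply: nearW => n /=.
have := euler_path_lipschitz (harmonic_gt0 n) (lexx 0) t0; rewrite euler_path0 subr0 => path_lip.
rewrite -(subrK x0 (euler_path _ t)) addrC (le_trans (ler_normD _ _))// lerD2l.
apply: le_trans path_lip _; rewrite ler_wpM2r// lerD2l.
by rewrite invf_le1 ?ltr0n// ler1n.
Qed.

Lemma euler_limit_exists : exists2 x : R -> V, x 0 = x0 & euler_limit x.
Proof.
have [U [UU sU]] := @ultraFilterLemma nat \oo _.
have UF : ProperFilter U by exact: ultra_proper.
have stepU : harmonic n @[n --> U] --> (0 : R).
  by apply: cvg_trans (@cvg_harmonic R) => A /sU.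
have path_cvg (t : R) : exists y : V, 0 <= t -> euler_path (harmonic n) t @[n --> U] --> y.
  have [t0|_] := leP 0 t; last by exists x0.
  by have [y] := euler_path_ultra_cvg UU t0; exists y.
have [x xP] := choice path_cvg; exists x.
  apply: (cvg_unique _ (xP 0 (lexx 0))) => //.
  rewrite (_ : (fun n => euler_path (harmonic n) 0) = fun=> x0); first exact: cvg_cst.
  by apply/funext => n; exact: euler_path0.
move=> s t y c r e s0 st f_near x_near; have t0 := le_trans s0 st.
have path_norm_cvg : `|euler_path (harmonic n) t - euler_path (harmonic n) s - (t - s) *: c|
    @[n --> U] --> `|x t - x s - (t - s) *: c|.
  by apply: cvg_norm; apply: cvgB; [apply: cvgB; exact: xP|exact: cvg_cst].
have gap_cvg : t - s + harmonic n @[n --> U] --> t - s + 0 by apply: cvgD => //; exact: cvg_cst.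
have bound_cvg :
    (t - s + harmonic n) * e + harmonic n * `|c| @[n --> U] --> (t - s + 0) * e + 0 * `|c|.
  by apply: cvgD; apply: cvgM => //; exact: cvg_cst.
rewrite addr0 mul0r addr0 in bound_cvg; apply: ler_cvg_to path_norm_cvg bound_cvg _.
have radius_cvg : `|euler_path (harmonic n) s - y| + (t - s + harmonic n) * L @[n --> U] -->
    `|x s - y| + (t - s + 0) * L.
  apply: cvgD; last by apply: cvgM => //; exact: cvg_cst.
  by apply: cvg_norm; apply: cvgB; [exact: xP|exact: cvg_cst].
rewrite addr0 in radius_cvg; have radius_le := @cvgr_le _ _ U _ _ _ radius_cvg _ x_near.
by near=> n; apply: euler_path_near (harmonic_gt0 n) s0 st f_near _; near: n; exact: radius_le.
Unshelve. all: by end_near. Qed.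

Lemma euler_limit_lipschitz (x : R -> V) (s t : R) : euler_limit x ->
  0 <= s -> s <= t -> `|x t - x s| <= (t - s) * L.
Proof.
move=> x_lim s0 st; have := @x_lim s t (x s) 0 ((t - s) * L + 1) L s0 st.
rewrite scaler0 subr0 subrr normr0 add0r ltrDl ltr01; apply=> // z _.
by rewrite subr0.
Qed.

Lemma euler_limit_near (x : R -> V) (t e : R) : euler_limit x -> 0 <= t -> 0 < e ->
  exists2 d : R, 0 < d & forall s u, 0 <= s -> s <= u -> `|s - t| <= d -> `|u - t| <= d ->
    `|x u - x s - (u - s) *: f (x t)| <= (u - s) * e.
Proof.
move=> x_lim t0 e0; have /cvgrPdist_le/(_ _ e0)/nbhs_ballP[r /= r0] := @fcont (x t).
rewrite -ball_normE/= => f_near.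
have L_gt0 : 0 < 3 * L + 1 by rewrite ltr_wpDl// mulr_ge0.
pose d := r / 2 / (3 * L + 1); have d0 : 0 < d by rewrite !divr_gt0.
have dE : d * (3 * L + 1) = r / 2 by rewrite divfK ?gt_eqF.
exists d => // s u s0 su sd ud.
apply: (x_lim s u (x t) _ (r / 2)) => // [z zt|].
  by rewrite distrC; apply: f_near; rewrite /= distrC; lra.
have xst : `|x s - x t| <= `|s - t| * L.
  have [ts|/ltW st] := leP t s.
    by rewrite (@ger0_norm _ (s - t)) ?subr_ge0//; exact: euler_limit_lipschitz.
  rewrite distrC (distrC s) (@ger0_norm _ (t - s)) ?subr_ge0//.
  exact: euler_limit_lipschitz.
have dist_le : `|s - t| * L <= d * L by rewrite ler_wpM2r.
have gap_le : (u - s) * L <= 2 * d * L.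
  by rewrite ler_wpM2r//; move: sd ud; rewrite !ler_norml => /andP[? ?] /andP[? ?]; lra.
lra.
Qed.

Lemma euler_limit_trajectory (x : R -> V) : euler_limit x -> trajectory x (f \o x).
Proof.
move=> x_lim; split.
  apply/cvgrPdist_le => e e0; have L1 : 0 < L + 1 by rewrite ltr_wpDl.
  near=> t; have t0 : 0 < t by [].
  rewrite distrC (le_trans (euler_limit_lipschitz x_lim (lexx 0) (ltW t0)))// subr0.
  apply: le_trans (_ : t * (L + 1) <= _); first by rewrite ler_wpM2l ?ltW// ltrDl.
  by rewrite -ler_pdivlMr//; near: t; apply: nbhs_right_le; rewrite divr_gt0.
move=> t t0; apply/is_deriveP/cvgrPdist_le => e e0.
have [d d0 x_near] := euler_limit_near x_lim (ltW t0) e0.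
near=> h.
have h_neq0 : h != 0 by near: h; exact: nbhs_dnbhs_neq.
have ht : `|h| < t by near: h; exact: dnbhs0_lt.
have hd : `|h| <= d by near: h; exact: dnbhs0_le.
have ht0 : 0 <= h + t by move: ht; rewrite ltr_norml => /andP[? _]; lra.
rewrite [h *: 1]mulr1 distrC -(@ler_pM2l _ `|h|) ?normr_gt0// -normrZ scalerBr scalerA.
rewrite mulfV// scale1r.
have [h0|h0] := ltP 0 h.
  have := x_near t (h + t) (ltW t0); rewrite addrK subrr normr0 lerDr (ltW h0) (ltW d0) hd.
  by rewrite (gtr0_norm h0); apply.
have := x_near (h + t) t ht0; rewrite addrK subrr normr0 (ltW d0) hd gerDr h0.
rewrite opprD addrCA subrr addr0 (ler0_norm h0) scaleNr opprK -normrN opprD opprB.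
exact.
Unshelve. all: by end_near. Qed.

Theorem peano : exists2 x : R -> V, x 0 = x0 & trajectory x (f \o x).
Proof.
have [x xx0 x_lim] := euler_limit_exists.
by exists x => //; exact: euler_limit_trajectory.
Qed.

End peano.

(** * Autonomous systems with a Lyapunov function *)

Section lie_derivatives.
Context {R : realType} {S : normedModType R} (F : S -> S).
Implicit Types (V W : normedModType R).

(* [df] is the derivative of [f] along the solutions of [X' = F X]; the factor [c] accounts
   for reparametrizations of time. *)
Definition is_lie V (f df : S -> V) := forall (X : R -> S) (t c : R),
  is_derive t 1 X (c *: F (X t)) -> is_derive t 1 (f \o X) (c *: df (X t)).

Lemma eq_is_lie V (f f' df df' : S -> V) :
  f =1 f' -> df =1 df' -> is_lie f df -> is_lie f' df'.
Proof. by move=> /funext-> /funext->. Qed.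

Lemma is_lie_id : is_lie id F.
Proof. by []. Qed.

Lemma is_lie_cst V (a : V) : is_lie (fun=> a) (fun=> 0).
Proof. by move=> X t c _; rewrite scaler0; exact: is_derive_cst. Qed.

Lemma is_lieD V (f g df dg : S -> V) : is_lie f df -> is_lie g dg ->
  is_lie (fun x => f x + g x) (fun x => df x + dg x).
Proof.
move=> fP gP X t c XP; rewrite scalerDr.
exact: is_deriveD (fP _ _ _ XP) (gP _ _ _ XP).
Qed.

Lemma is_lieB V (f g df dg : S -> V) : is_lie f df -> is_lie g dg ->
  is_lie (fun x => f x - g x) (fun x => df x - dg x).
Proof.
move=> fP gP X t c XP; rewrite scalerBr.
exact: is_deriveB (fP _ _ _ XP) (gP _ _ _ XP).
Qed.

Lemma is_lieBr V (f df : S -> V) (a : V) : is_lie f df -> is_lie (fun x => f x - a) df.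
Proof. by move=> fP; apply: (eq_is_lie _ _ (is_lieB fP (is_lie_cst a))) => x //; rewrite subr0. Qed.

Lemma is_lieZ V (k : R) (f df : S -> V) : is_lie f df ->
  is_lie (fun x => k *: f x) (fun x => k *: df x).
Proof.
move=> fP X t c XP; rewrite scalerA mulrC -scalerA.
exact: is_deriveZ (fP _ _ _ XP).
Qed.

Lemma is_lie_sum V n (f df : 'I_n -> S -> V) : (forall i, is_lie (f i) (df i)) ->
  is_lie (fun x => \sum_i f i x) (fun x => \sum_i df i x).
Proof.
move=> fP X t c XP; rewrite scaler_sumr.
have := is_derive_sum (fun i => fP i X t c XP).
by rewrite fct_sumE.
Qed.

Lemma is_lieM (f g df dg : S -> R) : is_lie f df -> is_lie g dg ->
  is_lie (fun x => f x * g x) (fun x => df x * g x + f x * dg x).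
Proof.
move=> fP gP X t c XP; apply: is_derive_eq (is_deriveM (fP _ _ _ XP) (gP _ _ _ XP)) _.
by rewrite /GRing.scale/=; ring.
Qed.

Lemma is_lieMl (k : R) (f df : S -> R) : is_lie f df ->
  is_lie (fun x => k * f x) (fun x => k * df x).
Proof. exact: is_lieZ. Qed.

Lemma is_lie_fst V W (f df : S -> V * W) : is_lie f df ->
  is_lie (fun x => (f x).1) (fun x => (df x).1).
Proof. by move=> fP X t c /fP/is_derive_pairP[]. Qed.

Lemma is_lie_snd V W (f df : S -> V * W) : is_lie f df ->
  is_lie (fun x => (f x).2) (fun x => (df x).2).
Proof. by move=> fP X t c /fP/is_derive_pairP[]. Qed.

Lemma is_lie_mxP m n (f df : S -> 'M[R]_(m, n)) :
  is_lie f df <-> forall i j, is_lie (fun x => f x i j) (fun x => df x i j).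
Proof.
split=> [fP i j X t c /fP/is_derive_mxP/(_ i j)|fP X t c XP]; first by rewrite mxE.
by apply/is_derive_mxP => i j; rewrite mxE; exact: fP.
Qed.

Lemma is_lie_col m n (f df : S -> 'M[R]_(m, n)) j : is_lie f df ->
  is_lie (fun x => col j (f x)) (fun x => col j (df x)).
Proof.
move=> /is_lie_mxP fP; apply/is_lie_mxP => i k.
by apply: (eq_is_lie _ _ (fP i j)) => x; rewrite mxE.
Qed.

Lemma is_lie_mulmx m n k (A dA : S -> 'M[R]_(m, n)) (B dB : S -> 'M[R]_(n, k)) :
  is_lie A dA -> is_lie B dB ->
  is_lie (fun x => A x *m B x) (fun x => dA x *m B x + A x *m dB x).
Proof.
move=> /is_lie_mxP AP /is_lie_mxP BP; apply/is_lie_mxP => i j.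
apply: (eq_is_lie _ _ (is_lie_sum (fun h => is_lieM (AP i h) (BP h j)))) => x; rewrite !mxE//.
exact: big_split.
Qed.

Lemma is_lie_mulmxr m n k (A : 'M[R]_(m, n)) (B dB : S -> 'M[R]_(n, k)) :
  is_lie B dB -> is_lie (fun x => A *m B x) (fun x => A *m dB x).
Proof.
move=> BP; apply: (eq_is_lie _ _ (is_lie_mulmx (is_lie_cst A) BP)) => x //.
by rewrite mul0mx add0r.
Qed.

Lemma is_lie_diff_comp V W (g : V -> W) (f df : S -> V) :
  (forall y, differentiable g y) -> is_lie f df ->
  is_lie (g \o f) (fun x => 'd g (f x) (df x)).
Proof.
move=> gdiff fP X t c /fP/(is_derive_diff_comp (gdiff _)) gfP.
by apply: is_derive_eq gfP _; rewrite linearZ.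
Qed.

Lemma is_lie_trajectory V (f df : S -> V) (chi : R -> R) (X : R -> S) :
  continuous f -> is_lie f df -> trajectory X (fun t => chi t *: F (X t)) ->
  trajectory (f \o X) (fun t => chi t *: df (X t)).
Proof.
move=> fcont fP [X0 XP]; split; first exact: (cvg_comp _ _ X0 (fcont (X 0))).
by move=> t t0; exact: fP (XP t t0).
Qed.

Lemma is_lie_solution V (f df : S -> V) (X : R -> S) :
  continuous f -> is_lie f df -> trajectory X (F \o X) -> trajectory (f \o X) (df \o X).
Proof.
move=> fcont fP [X0 XP].
have [|fX0 fXP] := @is_lie_trajectory V f df (fun=> 1) X fcont fP.
  by split=> // t t0; rewrite scale1r; exact: XP.
by split=> // t t0; have := fXP t t0; rewrite scale1r.
Qed.

End lie_derivatives.

Section autonomous_system.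
Context {R : realType} {S : normedModType R} (F : S -> S).
Hypothesis Sproper : proper_space S.
Hypothesis Fcont : continuous F.

Definition cutoff (B : R) (x : S) : R := Num.min 1 (Num.max 0 (B + 1 - `|x|)).

Lemma cutoff_ge0 B x : 0 <= cutoff B x.
Proof. by rewrite le_min ler01 le_max lexx. Qed.

Lemma cutoff_le1 B x : cutoff B x <= 1.
Proof. by rewrite ge_min lexx. Qed.

Lemma cutoff_eq1 B x : `|x| <= B -> cutoff B x = 1.
Proof. by move=> xB; rewrite /cutoff min_l// le_max lerBrDr addrC lerD2r xB orbT. Qed.

Lemma cutoff_eq0 B x : B + 1 <= `|x| -> cutoff B x = 0.
Proof. by move=> Bx; rewrite /cutoff max_l ?min_r// subr_le0. Qed.

Lemma continuous_cutoff B : continuous (cutoff B).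
Proof.
move=> x; apply: (@continuous_min _ _ (cst 1) (fun x => Num.max 0 (B + 1 - `|x|))).
  exact: cvg_cst.
apply: (@continuous_max _ _ (cst 0) (fun x => B + 1 - `|x|)); first exact: cvg_cst.
by apply: cvgB; [exact: cvg_cst|apply: cvg_norm; exact: cvg_id].
Qed.

(* [F] is cut off outside the ball of radius [B] to make it bounded, as [peano] requires:
   the solutions of the new system are reparametrized solutions of the old one, hence
   never leave this ball. *)
Lemma bounded_global_solution (B : R) (x0 : S) :
  (forall (chi : R -> R) (X : R -> S), (forall t, 0 <= chi t) -> X 0 = x0 ->
     trajectory X (fun t => chi t *: F (X t)) -> forall t, 0 <= t -> `|X t| <= B) ->
  exists2 X : R -> S, X 0 = x0 & trajectory X (F \o X).
Proof.
move=> apriori_bound; pose G x := cutoff B x *: F x.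
have [L FL] := continuous_ball_bounded (B + 1) Sproper Fcont.
have Gcont : continuous G.
  by move=> x; apply: cvgZ; [exact: continuous_cutoff|exact: Fcont].
have GL x : `|G x| <= `|L|.
  rewrite normrZ ger0_norm ?cutoff_ge0//; have [xB|/ltW xB] := leP `|x| (B + 1).
    by rewrite -[leRHS]mul1r ler_pM ?cutoff_ge0 ?cutoff_le1// (le_trans (FL x xB))// ler_norm.
  by rewrite cutoff_eq0// mul0r.
have [X X0 XG] := peano x0 Sproper Gcont GL.
exists X => //; split=> [|t t0]; first exact: XG.1.
apply: is_derive_eq (XG.2 t t0) _; rewrite /= /G cutoff_eq1 ?scale1r//.
by apply: (apriori_bound (cutoff B \o X)) (ltW t0) => // s; exact: cutoff_ge0.
Qed.

Lemma bounded_solution_unif_continuous (X : R -> S) (g : S -> R) :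
  trajectory X (F \o X) -> bounded_on [set t | 0 <= t] X -> continuous g ->
  unif_continuous_gt0 (g \o X).
Proof.
move=> XF [B XB] gcont e e0.
have [L FL] := continuous_ball_bounded B Sproper Fcont.
have [d d0 g_near] := continuous_ball_unif_continuous B Sproper gcont e0.
have L0 : 0 <= L by apply: le_trans (FL (X 0) (XB 0 (lexx 0))).
have X_lip a b : 0 <= a -> a <= b -> `|X b - X a| <= L * (b - a).
  by move=> a0 ab; apply: trajectory_lipschitz XF _ a0 ab => t t0; exact/FL/XB/ltW.
have X_dist s t : 0 < s -> 0 < t -> `|X s - X t| <= L * `|s - t|.
  move=> s0 t0; have [/ltW ts|st] := ltP t s.
    by rewrite (@ger0_norm _ (s - t)) ?subr_ge0// X_lip// ltW.
  by rewrite distrC (distrC s) (@ger0_norm _ (t - s)) ?subr_ge0// X_lip// ltW.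
have L1 : 0 < L + 1 by rewrite ltr_wpDl.
exists (d / (L + 1)) => [|s t s0 t0]; first by rewrite divr_gt0.
rewrite ltr_pdivlMr// => st; apply: g_near; first exact: XB (ltW s0).
apply: le_lt_trans (X_dist s t s0 t0) _; apply: le_lt_trans st.
by rewrite mulrC ler_wpM2l// lerDl.
Qed.

Lemma bounded_solution_barbalat m n (X : R -> S) (f df : S -> 'M[R]_(m, n))
    (l : 'M[R]_(m, n)) :
  trajectory X (F \o X) -> bounded_on [set t | 0 <= t] X ->
  continuous f -> continuous df -> is_lie F f df ->
  f (X t) @[t --> +oo] --> l -> df (X t) @[t --> +oo] --> (0 : 'M[R]_(m, n)).
Proof.
move=> XF Xb fcont dfcont fP /cvg_mxP fX; apply/cvg_mxP => i j; rewrite mxE.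
have /trajectory_mxP/(_ i j) fXij := is_lie_solution fcont fP XF.
apply: barbalat fXij (fX i j) _.
apply: (@bounded_solution_unif_continuous X (fun x => df x i j)) => // x.
by have /cvg_mxP := dfcont x; exact.
Qed.

Context (U dU : S -> R).
Hypothesis Ucont : continuous U.
Hypothesis dUcont : continuous dU.
Hypothesis UP : is_lie F U dU.
Hypothesis U_ge0 : forall x, 0 <= U x.
Hypothesis dU_le0 : forall x, dU x <= 0.
Hypothesis U_coercive : forall u : R, bounded_on [set x | U x <= u] id.

Lemma lyapunov_nonincreasing (chi : R -> R) (X : R -> S) (a b : R) :
  (forall t, 0 <= chi t) -> trajectory X (fun t => chi t *: F (X t)) ->
  0 <= a -> a <= b -> U (X b) <= U (X a).
Proof.
move=> chi0 XF a0 ab.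
apply: (trajectory_nonincreasing (is_lie_trajectory Ucont UP XF) _ a0 ab) => t t0.
by apply: mulr_ge0_le0.
Qed.

Lemma lyapunov_global_solution (x0 : S) : exists2 X : R -> S, X 0 = x0 & trajectory X (F \o X).
Proof.
have [B UB] := U_coercive (U x0); apply: (@bounded_global_solution B x0) => chi X chi0 X0 XF t t0.
by apply: UB; rewrite -X0; exact: lyapunov_nonincreasing chi0 XF (lexx 0) t0.
Qed.

Context (X : R -> S).
Hypothesis XF : trajectory X (F \o X).

Let U_nonincreasing (a b : R) : 0 <= a -> a <= b -> U (X b) <= U (X a).
Proof.
apply: (@lyapunov_nonincreasing (fun=> 1)) => //.
by split=> [|t t0]; [exact: XF.1|rewrite scale1r; exact: XF.2].
Qed.

Lemma lyapunov_bounded : bounded_on [set t : R | 0 <= t] X.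
Proof.
have [B UB] := U_coercive (U (X 0)); exists B => t t0.
by apply: UB; exact: U_nonincreasing.
Qed.

Lemma lyapunov_derivative_cvg0 : dU (X t) @[t --> +oo] --> 0.
Proof.
have [|l Ul] := @nonincreasing_bounded_cvg _ (U \o X) 0 U_nonincreasing.
  by move=> t _; exact: U_ge0.
apply: barbalat (is_lie_solution Ucont UP XF) Ul _.
exact: bounded_solution_unif_continuous lyapunov_bounded dUcont.
Qed.

End autonomous_system.

(** * Euclidean inner product *)

Section inner_product.
Context {R : realType}.

Definition dot m (x y : 'cV[R]_m) : R := \sum_k x k ord0 * y k ord0.

Lemma dotE m (x y : 'cV[R]_m) : (x^T *m y) ord0 ord0 = dot x y.
Proof. by rewrite mxE; apply: eq_bigr => k _; rewrite mxE. Qed.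

Lemma dotC m (x y : 'cV[R]_m) : dot x y = dot y x.
Proof. by apply: eq_bigr => k _; rewrite mulrC. Qed.

Lemma dotDr m (x y z : 'cV[R]_m) : dot x (y + z) = dot x y + dot x z.
Proof. by rewrite -big_split; apply: eq_bigr => k _; rewrite mxE mulrDr. Qed.

Lemma dotZr m a (x y : 'cV[R]_m) : dot x (a *: y) = a * dot x y.
Proof. by rewrite mulr_sumr; apply: eq_bigr => k _; rewrite mxE mulrCA. Qed.

Lemma dotNr m (x y : 'cV[R]_m) : dot x (- y) = - dot x y.
Proof. by rewrite -scaleN1r dotZr mulN1r. Qed.

Lemma dotBr m (x y z : 'cV[R]_m) : dot x (y - z) = dot x y - dot x z.
Proof. by rewrite dotDr dotNr. Qed.

Lemma dot0r m (x : 'cV[R]_m) : dot x 0 = 0.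
Proof. by rewrite -(scale0r 0) dotZr mul0r. Qed.

Lemma dotDl m (x y z : 'cV[R]_m) : dot (x + y) z = dot x z + dot y z.
Proof. by rewrite dotC dotDr !(dotC z). Qed.

Lemma dotZl m a (x y : 'cV[R]_m) : dot (a *: x) y = a * dot x y.
Proof. by rewrite dotC dotZr dotC. Qed.

Lemma dotNl m (x y : 'cV[R]_m) : dot (- x) y = - dot x y.
Proof. by rewrite dotC dotNr dotC. Qed.

Lemma dotBl m (x y z : 'cV[R]_m) : dot (x - y) z = dot x z - dot y z.
Proof. by rewrite dotDl dotNl. Qed.

Lemma dot_suml m (I : finType) (P : pred I) (x : I -> 'cV[R]_m) y :
  dot (\sum_(i | P i) x i) y = \sum_(i | P i) dot (x i) y.
Proof.
rewrite exchange_big/=; apply: eq_bigr => k _.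
by rewrite summxE mulr_suml.
Qed.

Lemma dot_delta m (x : 'cV[R]_m) k : dot x (delta_mx k ord0) = x k ord0.
Proof.
rewrite /dot (big_only1 k)//= => [|j jk _]; first by rewrite mxE !eqxx mulr1.
by rewrite mxE (negbTE jk) mulr0.
Qed.

Lemma dot_mulmxr m n (A : 'M[R]_(m, n)) x y : dot x (A *m y) = dot (A^T *m x) y.
Proof. by rewrite -!dotE mulmxA trmx_mul trmxK. Qed.

Lemma dot_skew m (A : 'M[R]_m) x : A^T = - A -> dot x (A *m x) = 0.
Proof.
move=> AN; have : dot x (A *m x) = - dot x (A *m x).
  by rewrite {1}dot_mulmxr AN mulNmx dotNl dotC.
by lra.
Qed.

Lemma dot_ge0 m (x : 'cV[R]_m) : 0 <= dot x x.
Proof. by apply: sumr_ge0 => k _; rewrite -expr2 sqr_ge0. Qed.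

Lemma dot_entry m (x : 'cV[R]_m) k : x k ord0 ^+ 2 <= dot x x.
Proof.
by apply: (@ler_sum_term _ _ (fun k => x k ord0 * x k ord0)) => j; rewrite -expr2 sqr_ge0.
Qed.

Lemma norm_le_dot m (x : 'cV[R]_m) (r : R) : 0 <= r -> dot x x <= r ^+ 2 -> `|x| <= r.
Proof.
move=> r0 xr; apply/mx_norm_leP; split=> // i j; rewrite (ord1 j).
by rewrite -ler_sqr ?nnegrE// real_normK ?num_real// (le_trans (dot_entry _ _)).
Qed.

Lemma norm_le_dotD1 m (x : 'cV[R]_m) : `|x| <= dot x x + 1.
Proof.
have := dot_ge0 x; set r := dot x x => r0.
by apply: norm_le_dot; rewrite -?/r; nra.
Qed.

Lemma bounded_on_sqdot (T : Type) (A : set T) m (f : T -> 'cV[R]_m) (b : R) :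
  (forall x, A x -> dot (f x) (f x) <= b) -> bounded_on A f.
Proof.
move=> fb; exists (b + 1) => x Ax; apply: le_trans (norm_le_dotD1 (f x)) _.
by rewrite lerD2r fb.
Qed.

Lemma dot_gt0 m (x : 'cV[R]_m) : x != 0 -> 0 < dot x x.
Proof.
move=> x0; rewrite lt_neqAle dot_ge0 andbT eq_sym; apply: contraNneq x0 => xx0.
by rewrite -normr_eq0 eq_le normr_ge0 andbT norm_le_dot ?xx0 ?expr0n.
Qed.

Lemma dot_young m (a : R) (x y : 'cV[R]_m) : 0 < a ->
  dot x y <= a * dot x x + (4 * a)^-1 * dot y y.
Proof.
move=> a0; have := dot_ge0 ((2 * a) *: x - y).
rewrite dotBl !dotBr !dotZl !dotZr (dotC y x) => sqr_dist.
have a4 : 0 < 4 * a by rewrite mulr_gt0.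
rewrite -(ler_pM2l a4) mulrDr mulrA mulrA divff ?gt_eqF// mul1r; nra.
Qed.

Lemma ler_norm_dot m (x y : 'cV[R]_m) : `|dot x y| <= m%:R * (`|x| * `|y|).
Proof.
rewrite -dotE; apply: le_trans (ler_mx_entry _ _ _) _.
apply: le_trans (norm_mulmx_le _ _) _; rewrite ler_wpM2l// ler_wpM2r//.
by apply/mx_norm_leP; split=> // i j; rewrite mxE ler_mx_entry.
Qed.

Lemma dot_mulmx_bound m n (A : 'M[R]_(m, n)) : exists2 b : R, 0 <= b &
  forall x, dot (A *m x) (A *m x) <= b * dot x x.
Proof.
pose B := A^T *m A; exists (\sum_i \sum_j `|B i j|); first by do 2!apply: sumr_ge0 => ? _.
move=> x; rewrite dot_mulmxr dotC mulmxA -/B mulr_suml; apply: ler_sum => i _.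
rewrite mxE mulr_sumr mulr_suml; apply: ler_sum => j _.
apply: le_trans (ler_norm _) _; rewrite mulrCA !normrM ler_wpM2l//.
have := dot_entry x i; have := dot_entry x j.
rewrite -(real_normK (num_real (x i ord0))) -(real_normK (num_real (x j ord0))).
by nra.
Qed.

Lemma cvg_dot (T : Type) (F : set_system T) {FF : Filter F} m
    (x y : T -> 'cV[R]_m) (a b : 'cV[R]_m) :
  x t @[t --> F] --> a -> y t @[t --> F] --> b -> dot (x t) (y t) @[t --> F] --> dot a b.
Proof.
move=> /cvg_mxP xa /cvg_mxP yb; apply: cvg_sum => k.
by apply: cvgM; [exact: xa|exact: yb].
Qed.

Lemma cvg0_sqdot (T : Type) (F : set_system T) {FF : Filter F} m (x : T -> 'cV[R]_m) :
  dot (x t) (x t) @[t --> F] --> 0 -> x t @[t --> F] --> (0 : 'cV[R]_m).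
Proof.
move=> /cvgr0Pnorm_le xx0; apply/cvgr0Pnorm_le => e e0; rewrite near_simpl.
have e20 : 0 < e ^+ 2 by rewrite exprn_gt0.
apply: filterS (xx0 _ e20) => t; rewrite ger0_norm ?dot_ge0//.
exact: norm_le_dot (ltW e0).
Qed.

Lemma cvg0_dot_bounded (T : Type) (F : set_system T) {FF : Filter F} m
    (x y : T -> 'cV[R]_m) (B : R) :
  x t @[t --> F] --> (0 : 'cV[R]_m) -> (\forall t \near F, `|y t| <= B) ->
  dot (x t) (y t) @[t --> F] --> 0.
Proof.
move=> /cvgr0Pnorm_le x0 yB; apply/cvgr0Pnorm_le => e e0.
pose k := m%:R * `|B| + 1; have k0 : 0 < k by rewrite ltr_wpDl// mulr_ge0.
have ek : 0 < e / k by rewrite divr_gt0.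
have x_small := x0 _ ek; near=> t; apply: le_trans (ler_norm_dot _ _) _.
apply: le_trans (_ : m%:R * (e / k * `|B|) <= _); last first.
  by rewrite mulrCA mulrAC ler_pdivrMr// ler_pM2l// lerDl.
rewrite ler_wpM2l// ler_pM//; first by near: t.
by rewrite (le_trans _ (ler_norm B))//; near: t.
Unshelve. all: by end_near. Qed.

Lemma is_lie_dot (S : normedModType R) (F : S -> S) m (f g df dg : S -> 'cV[R]_m) :
  is_lie F f df -> is_lie F g dg ->
  is_lie F (fun x => dot (f x) (g x)) (fun x => dot (df x) (g x) + dot (f x) (dg x)).
Proof.
move=> /is_lie_mxP fP /is_lie_mxP gP.
apply: (eq_is_lie _ _ (is_lie_sum (fun k => is_lieM (fP k ord0) (gP k ord0)))) => x //.
exact: big_split.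
Qed.

Lemma is_lie_sqdot (S : normedModType R) (F : S -> S) m (f df : S -> 'cV[R]_m) :
  is_lie F f df -> is_lie F (fun x => 2^-1 * dot (f x) (f x)) (fun x => dot (f x) (df x)).
Proof.
move=> fP; apply: (eq_is_lie _ _ (is_lieMl 2^-1 (is_lie_dot fP fP))) => x //.
by rewrite (dotC (df x)); field.
Qed.

End inner_product.

Section coercive_matrices.
Context {R : realType}.

Definition coercive_mx m (k : R) (A : 'M[R]_m) := forall x, k * dot x x <= dot x (A *m x).

Lemma dot_gt0_unitmx m (A : 'M[R]_m) :
  (forall x : 'cV[R]_m, x != 0 -> 0 < dot x (A *m x)) -> A \in unitmx.
Proof.
move=> A_gt0; rewrite -row_free_unit -kermx_eq0; apply/rowV0P => u /sub_kermxP uA.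
apply/eqP/negPn/negP => u0; have := A_gt0 u^T; rewrite -dotE mulmxA trmxK uA mul0mx.
by rewrite mxE ltxx trmx_eq0 u0 => /(_ isT).
Qed.

Lemma coercive_unitmx m (k : R) (A : 'M[R]_m) : 0 < k -> coercive_mx k A -> A \in unitmx.
Proof.
move=> k0 kA; apply: dot_gt0_unitmx => x x0.
by apply: lt_le_trans (kA x); rewrite mulr_gt0// dot_gt0.
Qed.

Lemma posdef_dot_gt0 m (A : 'M[R]_m) x : posdef A -> x != 0 -> 0 < dot x (A *m x).
Proof. by move=> [_ A_gt0] /A_gt0; rewrite -dotE mulmxA. Qed.

Lemma posdef_dot_ge0 m (A : 'M[R]_m) x : posdef A -> 0 <= dot x (A *m x).
Proof.
move=> Apos; have [->|/(posdef_dot_gt0 Apos)/ltW//] := eqVneq x 0.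
by rewrite mulmx0 dot0r.
Qed.

Lemma posdef_cauchy_schwarz m (A : 'M[R]_m) x y : posdef A ->
  dot x (A *m y) ^+ 2 <= dot x (A *m x) * dot y (A *m y).
Proof.
move=> Apos; have [->|/(posdef_dot_gt0 Apos) yy0] := eqVneq y 0.
  by rewrite mulmx0 !dot0r expr0n mulr0.
have := posdef_dot_ge0 (dot y (A *m y) *: x - dot x (A *m y) *: y) Apos.
rewrite mulmxBr -!scalemxAr dotBl !dotBr !dotZl !dotZr.
rewrite (dot_mulmxr A y x) Apos.1 (dotC (A *m y) x) => sqr_ge0.
by rewrite -(ler_pM2l yy0); nra.
Qed.

Lemma posdef_coercive m (A : 'M[R]_m) : posdef A -> exists2 k : R, 0 < k & coercive_mx k A.
Proof.
move=> Apos; have Au := dot_gt0_unitmx (fun x => @posdef_dot_gt0 _ A x Apos).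
pose y k := invmx A *m delta_mx k ord0 : 'cV[R]_m.
have Ay k : A *m y k = delta_mx k ord0 by rewrite mulKVmx.
have yAy_ge0 : 0 <= \sum_k dot (y k) (A *m y k).
  by apply: sumr_ge0 => k _; exact: posdef_dot_ge0.
exists (1 + \sum_k dot (y k) (A *m y k))^-1; first by rewrite invr_gt0 ltr_wpDr.
move=> x; rewrite mulrC ler_pdivrMr ?ltr_wpDr// mulrDr mulr1.
rewrite -[leLHS]add0r lerD ?posdef_dot_ge0// mulr_sumr; apply: ler_sum => k _.
by rewrite -expr2 -dot_delta -Ay posdef_cauchy_schwarz.
Qed.

Lemma diag_posdef m (D : 'M[R]_m) : is_diag_mx D -> (forall k, 0 < D k k) -> posdef D.
Proof.
move=> /diag_mxP[d ->] d_gt0; split=> [|x x0]; first exact: tr_diag_mx.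
rewrite -mulmxA dotE lt_neqAle.
have term_ge0 k : 0 <= x k ord0 * (diag_mx d *m x) k ord0.
  have := d_gt0 k; rewrite mul_diag_mx !mxE eqxx mulr1n => dk.
  by rewrite mulrCA mulr_ge0 ?(ltW dk)// -expr2 sqr_ge0.
rewrite sumr_ge0// andbT eq_sym; apply: contraNneq x0 => /eqP.
rewrite psumr_eq0// => /allP entry0; apply/eqP/colP => k.
have := entry0 k (mem_index_enum k); have := d_gt0 k.
rewrite mul_diag_mx !mxE eqxx mulr1n /= mulrCA -expr2 mulf_eq0 sqrf_eq0.
by move=> /gt_eqF-> /eqP.
Qed.

End coercive_matrices.

(** * The matrices of the leader *)

Section leader_matrices.
Context {R : realType}.

Lemma mxvec_index_eq m n (i i' : 'I_m) (k k' : 'I_n) :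
  (mxvec_index i k == mxvec_index i' k') = (i == i') && (k == k').
Proof.
apply/eqP/andP => [|[/eqP-> /eqP->]//].
by move=> /cast_ord_inj/enum_rank_inj[-> ->].
Qed.

Lemma sum_mxvec_index m n (V : nmodType) (f : 'I_(m * n) -> V) :
  \sum_r f r = \sum_i \sum_k f (mxvec_index i k).
Proof.
rewrite (reindex _ (curry_mxvec_bij _ _))/= pair_bigA/=.
by apply: eq_bigr => -[].
Qed.

Lemma kronE m1 n1 m2 n2 (A : 'M[R]_(m1, n1)) (B : 'M[R]_(m2, n2)) i k j h :
  kron A B (mxvec_index i k) (mxvec_index j h) = A i j * B k h.
Proof.
rewrite mxE (big_only1 i) => [|//|i' ii' _]; last first.
  by do 3!rewrite big1// => ? _; rewrite mxvec_index_eq eq_sym (negbTE ii') mul0r.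
rewrite (big_only1 k) => [|//|k' kk' _]; last first.
  by do 2!rewrite big1// => ? _; rewrite mxvec_index_eq (eq_sym k) (negbTE kk') andbF mul0r.
rewrite (big_only1 j) => [|//|j' jj' _]; last first.
  by rewrite big1// => ? _; rewrite (mxvec_index_eq j) (eq_sym j) (negbTE jj') andbF mul0r.
rewrite (big_only1 h) => [|//|h' hh' _]; last first.
  by rewrite (mxvec_index_eq j) (eq_sym h) (negbTE hh') !andbF mul0r.
by rewrite !eqxx mul1r.
Qed.

Lemma SmatE l (z : 'cV[R]_l) i k j h :
  Smat z (mxvec_index i k) (mxvec_index j h) = amat R k h *+ (i == j) * z i ord0.
Proof.
rewrite kronE mxE mxE; have [->|_] := eqVneq i j; first by rewrite !mulr1n mulrC.
by rewrite !mulr0n !mul0r.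
Qed.

Lemma SmatB l (z w : 'cV[R]_l) : Smat (z - w) = Smat z - Smat w.
Proof.
apply/matrixP => r c; case/mxvec_indexP: r => i k; case/mxvec_indexP: c => j h.
by rewrite [RHS]mxE [X in _ = _ + X]mxE !SmatE -mulrBr !mxE.
Qed.

Lemma Smat_skew l (z : 'cV[R]_l) : (Smat z)^T = - Smat z.
Proof.
apply/matrixP => r c; case/mxvec_indexP: r => i k; case/mxvec_indexP: c => j h.
rewrite mxE [RHS]mxE !SmatE eq_sym; have [->|_] := eqVneq i j; last first.
  by rewrite !mulr0n !mul0r oppr0.
rewrite !mulr1n -mulNr; congr (_ * _).
by case: k => -[|[|//]] ?; case: h => -[|[|//]] ?; rewrite !mxE -!val_eqE/= ?oppr0 ?opprK.
Qed.

Lemma mul_SmatE l (z : 'cV[R]_l) (y : 'cV[R]_(l * 2)) i k :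
  (Smat z *m y) (mxvec_index i k) ord0 =
  z i ord0 * \sum_h amat R k h * y (mxvec_index i h) ord0.
Proof.
rewrite mxE sum_mxvec_index (big_only1 i) => [|//|j ji _]; last first.
  by rewrite big1// => h _; rewrite SmatE eq_sym (negbTE ji) mulr0n !mul0r.
by rewrite mulr_sumr; apply: eq_bigr => h _; rewrite SmatE eqxx mulr1n mulrAC mulrC.
Qed.

Lemma mul_phiE l (x y : 'cV[R]_(l * 2)) k : (phi x *m y) k ord0 =
  x (mxvec_index k i0_2) ord0 * y (mxvec_index k i1_2) ord0 -
  x (mxvec_index k i1_2) ord0 * y (mxvec_index k i0_2) ord0.
Proof.
have sum_eq a (u : R) : \sum_r (r == a)%:R * u * y r ord0 = u * y a ord0.
  rewrite (big_only1 a) => [|//|r ra _]; first by rewrite eqxx mul1r.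
  by rewrite (negbTE ra) !mul0r.
rewrite -mulNr addrC -!sum_eq -big_split mxE; apply: eq_bigr => r _.
by rewrite mxE mulrDl.
Qed.

Lemma dot_phi l (w : 'cV[R]_l) (e y : 'cV[R]_(l * 2)) :
  dot w (phi e *m y) = dot e (Smat w *m y).
Proof.
have lift0E : lift ord0 ord0 = i1_2 :> 'I_2 by exact: val_inj.
rewrite [RHS]/dot sum_mxvec_index; apply: eq_bigr => k _; rewrite mul_phiE.
rewrite !big_ord_recl !big_ord0 !mul_SmatE !big_ord_recl !big_ord0 !mxE -!val_eqE/= lift0E.
by rewrite /i0_2; ring.
Qed.

Lemma norm_Smat_le l (z : 'cV[R]_l) : `|Smat z| <= `|z|.
Proof.
apply/mx_norm_leP; split=> // r c; case/mxvec_indexP: r => i k; case/mxvec_indexP: c => j h.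
rewrite SmatE normrM -[leRHS]mul1r ler_pM// ?ler_mx_entry//.
case: (i == j); rewrite ?mulr1n ?mulr0n ?normr0// mxE.
by case: ifP => _; [|case: ifP => _]; rewrite ?normrN ?normr1 ?normr0.
Qed.

Lemma cvg_Smat (T : Type) (F : set_system T) {FF : Filter F} l (z : T -> 'cV[R]_l)
    (a : 'cV[R]_l) :
  z t @[t --> F] --> a -> Smat (z t) @[t --> F] --> Smat a.
Proof.
move=> /cvg_mxP za; apply/cvg_mxP => r c.
case/mxvec_indexP: r => i k; case/mxvec_indexP: c => j h.
under eq_fun do rewrite SmatE; rewrite SmatE.
by apply: cvgM; [exact: cvg_cst|exact: za].
Qed.

Lemma is_lie_Smat (S : normedModType R) (F : S -> S) l (z dz : S -> 'cV[R]_l) :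
  is_lie F z dz -> is_lie F (fun x => Smat (z x)) (fun x => Smat (dz x)).
Proof.
move=> /is_lie_mxP zP; apply/is_lie_mxP => r c.
case/mxvec_indexP: r => i k; case/mxvec_indexP: c => j h.
by apply: (eq_is_lie _ _ (is_lieMl (amat R k h *+ (i == j)) (zP i ord0))) => x; rewrite SmatE.
Qed.

Lemma cvg_phi (T : Type) (F : set_system T) {FF : Filter F} l (x : T -> 'cV[R]_(l * 2))
    (a : 'cV[R]_(l * 2)) :
  x t @[t --> F] --> a -> phi (x t) @[t --> F] --> phi a.
Proof.
move=> /cvg_mxP xa; apply/cvg_mxP => k r; under eq_fun do rewrite mxE; rewrite mxE.
apply: cvgD; apply: cvgM; try exact: cvg_cst; last exact: xa.
by apply: cvgN; exact: xa.
Qed.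

End leader_matrices.

(** * Dirichlet form of the communication graph *)

Section communication_graph.
Context {R : realType} (N m : nat) (E : rel 'I_N.+1).
Implicit Types (v w : 'cV[R]_m) (eta u : 'I_N -> 'cV[R]_m) (i : 'I_N).

Definition leader_weight i : R := (E ord0 (lift ord0 i))%:R.
Definition follower_weight i (j : 'I_N) : R := (E (lift ord0 j) (lift ord0 i))%:R.

Definition disagreement v eta i : 'cV[R]_m :=
  \sum_(j < N.+1 | E j (lift ord0 i)) (nodeval v eta j - eta i).

Definition dirichlet v eta w u : R :=
  2^-1 * (\sum_i \sum_j follower_weight i j * dot (eta i - eta j) (u i - u j)) +
  \sum_i leader_weight i * dot (eta i - v) (u i - w).

Lemma nodeval0 v eta : nodeval v eta ord0 = v.
Proof. by rewrite /nodeval unlift_none. Qed.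

Lemma nodeval_lift v eta i : nodeval v eta (lift ord0 i) = eta i.
Proof. by rewrite /nodeval liftK. Qed.

Lemma disagreementE v eta i : disagreement v eta i =
  leader_weight i *: (v - eta i) + \sum_j follower_weight i j *: (eta j - eta i).
Proof.
rewrite /disagreement big_mkcond big_ord_recl nodeval0 /leader_weight; congr (_ + _).
  by case: ifP; rewrite ?scale1r ?scale0r.
apply: eq_bigr => j _; rewrite nodeval_lift /follower_weight.
by case: ifP; rewrite ?scale1r ?scale0r.
Qed.

Lemma dirichletBr v eta w u w' u' :
  dirichlet v eta (w - w') (fun i => u i - u' i) = dirichlet v eta w u - dirichlet v eta w' u'.
Proof.
rewrite /dirichlet (opprD (2^-1 * _)) addrACA -mulrBr -!sumrB.
congr (_ * _ + _); apply: eq_bigr => i _.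
  rewrite -sumrB; apply: eq_bigr => j _; rewrite -mulrBr -dotBr.
  by rewrite (opprD (u j)) addrACA -opprD.
by rewrite -mulrBr -dotBr (opprD w) addrACA -opprD.
Qed.

Lemma dirichlet_cst v eta w : dirichlet v eta w (fun=> w) = 0.
Proof.
rewrite /dirichlet big1 => [|i _]; last by rewrite big1// => j _; rewrite subrr dot0r mulr0.
by rewrite mulr0 add0r big1// => i _; rewrite subrr dot0r mulr0.
Qed.

Lemma dirichlet_skew v eta (A : 'M[R]_m) : A^T = - A ->
  dirichlet v eta (A *m v) (fun i => A *m eta i) = 0.
Proof.
move=> Askew; rewrite /dirichlet big1 => [|i _]; last first.
  by rewrite big1// => j _; rewrite -mulmxBr dot_skew ?mulr0.
by rewrite mulr0 add0r big1// => i _; rewrite -mulmxBr dot_skew ?mulr0.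
Qed.

Lemma dirichlet_mod_skew v eta u (A : 'M[R]_m) : A^T = - A ->
  dirichlet v eta (A *m v) u = dirichlet v eta 0 (fun i => u i - A *m eta i).
Proof.
by move=> Askew; rewrite -(subrr (A *m v)) dirichletBr dirichlet_skew// subr0.
Qed.

Lemma dirichlet_ge0 v eta : 0 <= dirichlet v eta v eta.
Proof.
rewrite addr_ge0 ?mulr_ge0 ?invr_ge0//; last first.
  by apply: sumr_ge0 => i _; rewrite mulr_ge0 ?dot_ge0 ?ler0n.
by do 2![apply: sumr_ge0 => ? _]; rewrite mulr_ge0 ?dot_ge0 ?ler0n.
Qed.

Lemma dirichlet_edge v eta (j : 'I_N.+1) i : E j (lift ord0 i) ->
  dot (eta i - nodeval v eta j) (eta i - nodeval v eta j) <= 2 * dirichlet v eta v eta.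
Proof.
pose f i j := follower_weight i j * dot (eta i - eta j) (eta i - eta j).
pose g i := leader_weight i * dot (eta i - v) (eta i - v).
have f_ge0 i' j' : 0 <= f i' j' by rewrite mulr_ge0 ?dot_ge0 ?ler0n.
have g_ge0 k : 0 <= g k by rewrite mulr_ge0 ?dot_ge0 ?ler0n.
have sum_f_ge0 k : 0 <= \sum_j' f k j' by exact: sumr_ge0.
have -> : dirichlet v eta v eta = 2^-1 * (\sum_k \sum_j' f k j') + \sum_k g k by [].
have f_tot : 0 <= \sum_k \sum_j' f k j' by exact: sumr_ge0.
have g_tot : 0 <= \sum_k g k by exact: sumr_ge0.
case: (unliftP ord0 j) => [j' ->|->] Eji.
  have := ler_sum_term j' (f_ge0 i); have := ler_sum_term i sum_f_ge0.
  by rewrite nodeval_lift {1 3}/f /follower_weight Eji mul1r; lra.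
have := ler_sum_term i g_ge0.
by rewrite nodeval0 {1}/g /leader_weight Eji mul1r; lra.
Qed.

Hypothesis Eundirected : forall i j : 'I_N,
  E (lift ord0 i) (lift ord0 j) = E (lift ord0 j) (lift ord0 i).

Lemma sum_dot_disagreement v eta u :
  \sum_i dot (disagreement v eta i) (u i) = - dirichlet v eta 0 u.
Proof.
pose half := \sum_i \sum_j follower_weight i j * dot (eta i - eta j) (u i).
have half_sym : \sum_i \sum_j follower_weight i j * dot (eta i - eta j) (u j) = - half.
  rewrite exchange_big/= -sumrN; apply: eq_bigr => i _.
  rewrite -sumrN; apply: eq_bigr => j _.
  by rewrite /follower_weight Eundirected -mulrN -dotNl opprB.
have fullE :
    \sum_i \sum_j follower_weight i j * dot (eta i - eta j) (u i - u j) = half + half.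
  rewrite -[X in _ + X]opprK -half_sym -sumrB; apply: eq_bigr => i _.
  by rewrite -sumrB; apply: eq_bigr => j _; rewrite dotBr mulrBr.
have -> : \sum_i dot (disagreement v eta i) (u i) =
    - half - \sum_i leader_weight i * dot (eta i - v) (u i - 0).
  rewrite -!sumrN -big_split/=; apply: eq_bigr => i _.
  rewrite disagreementE [LHS]dotDl addrC -mulrN -dotNl opprB -sumrN subr0; congr (_ + _).
    by rewrite dotZl.
  rewrite dot_suml.
  by apply: eq_bigr => j _; rewrite dotZl -mulrN -dotNl opprB.
by rewrite /dirichlet fullE; lra.
Qed.

Lemma sum_dot_disagreement_error v eta :
  \sum_i dot (disagreement v eta i) (eta i - v) = - dirichlet v eta v eta.
Proof.
by rewrite sum_dot_disagreement -(subrr v) dirichletBr dirichlet_cst subr0.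
Qed.

Hypothesis Etree : has_spanning_tree E ord0.

Lemma spanning_tree_bound v eta (d : R) : 0 <= d ->
  (forall j i, E j (lift ord0 i) -> `|eta i - nodeval v eta j| <= d) ->
  forall i, `|eta i - v| <= N.+1%:R * d.
Proof.
move=> d0 edge_le i; have [T [TE [T0 [_ Tconnect]]]] := Etree.
have {}T0 j : ~~ T j ord0.
  apply/negP => Tj; have := card0_eq T0 j.
  by rewrite [X in X = _](_ : _ = true)//; apply/mem_set.
have tree_edge_le j k : T j k -> `|nodeval v eta k - nodeval v eta j| <= d.
  case: (unliftP ord0 k) => [k' ->|->] Tjk; last by have := T0 j; rewrite Tjk.
  by rewrite nodeval_lift; exact/edge_le/TE.
have path_le : forall p j, path T j p ->
    `|nodeval v eta (last j p) - nodeval v eta j| <= (size p)%:R * d.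
  elim=> [|k p IHp] j /=; first by rewrite subrr normr0 mul0r.
  move=> /andP[jk kp]; rewrite -(subrKA (nodeval v eta k)) (le_trans (ler_normD _ _))//.
  by rewrite -natr1 mulrDl mul1r lerD ?IHp ?tree_edge_le.
have /connectP[p Tp ip] := Tconnect (lift ord0 i).
case: (shortenP Tp) ip => p' Tp' up' _ ip; have := path_le _ _ Tp'.
rewrite -ip nodeval_lift nodeval0 => /le_trans; apply; rewrite ler_wpM2r// ler_nat.
have := max_card (mem (ord0 :: p')); rewrite (card_uniqP up') card_ord /=.
exact: ltnW.
Qed.

Lemma dirichlet_bound v eta i :
  `|eta i - v| <= N.+1%:R * Num.sqrt (2 * dirichlet v eta v eta).
Proof.
apply: spanning_tree_bound => [|j k Ejk]; first exact: sqrtr_ge0.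
apply: norm_le_dot; first exact: sqrtr_ge0.
by rewrite sqr_sqrtr ?mulr_ge0 ?dirichlet_ge0//; exact: dirichlet_edge.
Qed.

Lemma disagreement_cvg0 (T : Type) (F : set_system T) {FF : Filter F} (v : T -> 'cV[R]_m)
    (eta : 'I_N -> T -> 'cV[R]_m) (B : R) :
  (forall i, disagreement (v t) (eta ^~ t) i @[t --> F] --> (0 : 'cV[R]_m)) ->
  (forall i, \forall t \near F, `|eta i t - v t| <= B) ->
  forall i, eta i t - v t @[t --> F] --> (0 : 'cV[R]_m).
Proof.
move=> ev0 errB i; pose energy t := dirichlet (v t) (eta ^~ t) (v t) (eta ^~ t).
have energy0 : energy t @[t --> F] --> 0.
  have energyE : energy =
      fun t => - \sum_j dot (disagreement (v t) (eta ^~ t) j) (eta j t - v t).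
    by apply/funext => t; rewrite (sum_dot_disagreement_error (v t) (eta ^~ t)) opprK.
  have : \sum_j dot (disagreement (v t) (eta ^~ t) j) (eta j t - v t) @[t --> F] -->
      \sum_(j < N) (0 : R).
    by apply: cvg_sum => j; exact: cvg0_dot_bounded (ev0 j) (errB j).
  by rewrite big1_eq energyE => /cvgN; rewrite oppr0.
have sqrt_energy0 : Num.sqrt (2 * energy t) @[t --> F] --> Num.sqrt (2 * 0 : R).
  have energy20 : 2 * energy t @[t --> F] --> (2 * 0 : R) by apply: cvgM => //; exact: cvg_cst.
  exact: (cvg_comp _ _ energy20 (@sqrt_continuous _ _)).
rewrite mulr0 sqrtr0 in sqrt_energy0.
apply/norm_cvg0P; apply: (squeeze_cvgr (f := fun=> 0)
  (h := fun t => N.+1%:R * Num.sqrt (2 * energy t))).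
- by apply: nearW => t; rewrite normr_ge0/=; exact: (dirichlet_bound (v t) (eta ^~ t) i).
- exact: cvg_cst.
- by rewrite -[X in _ --> X](mulr0 (N.+1%:R : R)); apply: cvgM => //; exact: cvg_cst.
Qed.

Lemma cvg_dirichlet (T : Type) (F : set_system T) {FF : Filter F} (v w : T -> 'cV[R]_m)
    (eta u : 'I_N -> T -> 'cV[R]_m) (a b : 'cV[R]_m) (c d : 'I_N -> 'cV[R]_m) :
  v t @[t --> F] --> a -> (forall i, eta i t @[t --> F] --> c i) ->
  w t @[t --> F] --> b -> (forall i, u i t @[t --> F] --> d i) ->
  dirichlet (v t) (eta ^~ t) (w t) (u ^~ t) @[t --> F] --> dirichlet a c b d.
Proof.
move=> va etac wb ud; apply: cvgD.
  apply: cvgM; first exact: cvg_cst.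
  apply: cvg_sum => i; apply: cvg_sum => j; apply: cvgM; first exact: cvg_cst.
  by apply: cvg_dot; apply: cvgB.
apply: cvg_sum => i; apply: cvgM; first exact: cvg_cst.
by apply: cvg_dot; apply: cvgB.
Qed.

Lemma is_lie_dirichlet (S : normedModType R) (F : S -> S) (v dv : S -> 'cV[R]_m)
    (eta deta : 'I_N -> S -> 'cV[R]_m) :
  is_lie F v dv -> (forall i, is_lie F (eta i) (deta i)) ->
  is_lie F (fun x => 2^-1 * dirichlet (v x) (eta ^~ x) (v x) (eta ^~ x))
    (fun x => dirichlet (v x) (eta ^~ x) (dv x) (deta ^~ x)).
Proof.
move=> vP etaP.
have follower_lie i j := is_lie_sqdot (is_lieB (etaP i) (etaP j)).
have leader_lie i := is_lie_sqdot (is_lieB (etaP i) vP).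
have := is_lieD
  (is_lieMl 2^-1 (is_lie_sum (fun i => is_lie_sum (fun j =>
     is_lieMl (follower_weight i j) (follower_lie i j)))))
  (is_lie_sum (fun i => is_lieMl (leader_weight i) (leader_lie i))).
apply: eq_is_lie => x //; rewrite /dirichlet mulrDr; congr (_ + _); last first.
  by rewrite mulr_sumr; apply: eq_bigr => i _; rewrite mulrCA.
congr (_ * _); rewrite mulr_sumr; apply: eq_bigr => i _.
by rewrite mulr_sumr; apply: eq_bigr => j _; rewrite mulrCA.
Qed.

End communication_graph.

(** * Energies of the observer and of the adaptive controllers *)

Section observer_energy.
Context {R : realType} (N l : nat) (E : rel 'I_N.+1) (om0 : 'cV[R]_l) (mu1 mu2 : R).
Hypothesis mu2_gt0 : 0 < mu2.
Implicit Types (v : 'cV[R]_(l * 2)) (eta : 'I_N -> 'cV[R]_(l * 2)) (om : 'I_N -> 'cV[R]_l).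

Definition observer_energy v eta om : R := 2^-1 * dirichlet E v eta v eta +
  mu2^-1 * \sum_i (2^-1 * dot (om i - om0) (om i - om0)).

Let frequency_energy_ge0 om i : 0 <= 2^-1 * dot (om i - om0) (om i - om0).
Proof. by rewrite mulr_ge0 ?invr_ge0 ?dot_ge0. Qed.

Lemma dirichlet_le_observer_energy v eta om :
  dirichlet E v eta v eta <= 2 * observer_energy v eta om.
Proof.
rewrite mulrDr mulrA divff// mul1r lerDl !mulr_ge0 ?invr_ge0 ?(ltW mu2_gt0)//.
by apply: sumr_ge0 => i _; exact: frequency_energy_ge0.
Qed.

Lemma frequency_le_observer_energy v eta om i :
  dot (om i - om0) (om i - om0) <= 2 * mu2 * observer_energy v eta om.
Proof.
have := ler_sum_term i (frequency_energy_ge0 om); have := dirichlet_ge0 E v eta.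
rewrite /observer_energy mulrDr -[2 * mu2 * (mu2^-1 * _)]mulrA mulVKf ?gt_eqF//.
by move=> /(mulr_ge0 (ltW mu2_gt0)); lra.
Qed.

Lemma observer_energy_ge0 v eta om : 0 <= observer_energy v eta om.
Proof.
have := dirichlet_le_observer_energy v eta om; have := dirichlet_ge0 E v eta.
by lra.
Qed.

Lemma cvg_observer_energy (T : Type) (F : set_system T) {FF : Filter F} v eta om
    (v' : T -> 'cV[R]_(l * 2)) (eta' : 'I_N -> T -> 'cV[R]_(l * 2)) (om' : 'I_N -> T -> 'cV[R]_l) :
  v' t @[t --> F] --> v -> (forall i, eta' i t @[t --> F] --> eta i) ->
  (forall i, om' i t @[t --> F] --> om i) ->
  observer_energy (v' t) (eta' ^~ t) (om' ^~ t) @[t --> F] --> observer_energy v eta om.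
Proof.
move=> vcvg etacvg omcvg; apply: cvgD; apply: cvgM; try exact: cvg_cst.
  exact: cvg_dirichlet.
apply: cvg_sum => i; apply: cvgM; first exact: cvg_cst.
by apply: cvg_dot; apply: cvgB => //; exact: cvg_cst.
Qed.

Hypothesis Eundirected : forall i j : 'I_N,
  E (lift ord0 i) (lift ord0 j) = E (lift ord0 j) (lift ord0 i).
Context (S : normedModType R) (F : S -> S) (v : S -> 'cV[R]_(l * 2))
  (eta : 'I_N -> S -> 'cV[R]_(l * 2)) (om : 'I_N -> S -> 'cV[R]_l).
Let ev i x := disagreement E (v x) (eta ^~ x) i.
Hypothesis vP : is_lie F v (fun x => Smat om0 *m v x).
Hypothesis etaP : forall i,
  is_lie F (eta i) (fun x => Smat (om i x) *m eta i x + mu1 *: ev i x).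
Hypothesis omP : forall i, is_lie F (om i) (fun x => mu2 *: (phi (ev i x) *m eta i x)).

(* The update law of [om] cancels the terms [ev . S(om - om0) eta] coming from the wrong
   frequencies. *)
Lemma is_lie_observer_energy :
  is_lie F (fun x => observer_energy (v x) (eta ^~ x) (om ^~ x))
    (fun x => - (mu1 * \sum_i dot (ev i x) (ev i x))).
Proof.
have := is_lieD (is_lie_dirichlet E vP etaP)
  (is_lieMl mu2^-1 (is_lie_sum (fun i => is_lie_sqdot (is_lieBr om0 (omP i))))).
apply: eq_is_lie => x //=; rewrite dirichlet_mod_skew; last exact: Smat_skew.
rewrite -[X in X + _]opprK -(sum_dot_disagreement Eundirected).
have -> : mu2^-1 * \sum_i dot (om i x - om0) (mu2 *: (phi (ev i x) *m eta i x)) =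
    \sum_i dot (ev i x) (Smat (om i x - om0) *m eta i x).
  rewrite mulr_sumr; apply: eq_bigr => i _.
  by rewrite dotZr mulKf ?gt_eqF// dot_phi.
rewrite mulr_sumr -!sumrN -big_split/=; apply: eq_bigr => i _.
by rewrite SmatB mulmxBl !dotBr dotDr dotZr -/(ev i x); ring.
Qed.

End observer_energy.

Section adaptive_energy.
Context {R : realType} (n p : nat).
Implicit Types (M : 'M[R]_n) (Lam : 'M[R]_p) (s : 'cV[R]_n) (w : 'cV[R]_p).

Definition adaptive_energy M s Lam w : R :=
  2^-1 * dot s (M *m s) + 2^-1 * dot w (Lam *m w).

Lemma adaptive_energy_ge (kM kL : R) M s Lam w : coercive_mx kM M -> coercive_mx kL Lam ->
  2^-1 * (kM * dot s s + kL * dot w w) <= adaptive_energy M s Lam w.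
Proof. by move=> kMM kLL; have := kMM s; have := kLL w; rewrite /adaptive_energy; lra. Qed.

Lemma cvg_adaptive_energy (T : Type) (F : set_system T) {FF : Filter F} M s Lam w
    (M' : T -> 'M[R]_n) (s' : T -> 'cV[R]_n) (w' : T -> 'cV[R]_p) :
  M' t @[t --> F] --> M -> s' t @[t --> F] --> s -> w' t @[t --> F] --> w ->
  adaptive_energy (M' t) (s' t) Lam (w' t) @[t --> F] --> adaptive_energy M s Lam w.
Proof.
move=> Mcvg scvg wcvg; apply: cvgD; apply: cvgM; try exact: cvg_cst.
  by apply: cvg_dot => //; exact: cvg_mulmx.
by apply: cvg_dot => //; exact: cvg_mulmxr.
Qed.

Context (S : normedModType R) (F : S -> S) (M : 'cV[R]_n -> 'M[R]_n) (Lam : 'M[R]_p)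
  (K : 'M[R]_n) (q qd s sd : S -> 'cV[R]_n) (w wd : S -> 'cV[R]_p)
  (Cm : S -> 'M[R]_n) (Y : S -> 'M[R]_(n, p)).
Hypothesis Mdiff : forall y, differentiable M y.
Hypothesis Msym : forall y, (M y)^T = M y.
Hypothesis Lam_sym : Lam^T = Lam.
Hypothesis Cskew : forall x, ('d M (q x) (qd x) - 2%:R *: Cm x)^T =
  - ('d M (q x) (qd x) - 2%:R *: Cm x).
Hypothesis qP : is_lie F q qd.
Hypothesis sP : is_lie F s sd.
Hypothesis wP : is_lie F w wd.
Hypothesis sdE : forall x, M (q x) *m sd x = - (K *m s x) + Y x *m w x - Cm x *m s x.
Hypothesis wdE : forall x, Lam *m wd x = - ((Y x)^T *m s x).

Lemma is_lie_adaptive_energy : is_lie F (fun x => adaptive_energy (M (q x)) (s x) Lam (w x))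
  (fun x => - dot (s x) (K *m s x)).
Proof.
have MqP := is_lie_diff_comp Mdiff qP.
have := is_lieD (is_lieMl 2^-1 (is_lie_dot sP (is_lie_mulmx MqP sP)))
  (is_lieMl 2^-1 (is_lie_dot wP (is_lie_mulmxr Lam wP))).
apply: eq_is_lie => x //=.
have inertia_rate :
    dot (s x) ('d M (q x) (qd x) *m s x) = 2 * dot (s x) (Cm x *m s x).
  have := dot_skew (s x) (Cskew x); rewrite mulmxBl dotBr -scalemxAl dotZr.
  by move=> /subr0_eq.
have inertia_sym : dot (sd x) (M (q x) *m s x) = dot (s x) (M (q x) *m sd x).
  by rewrite dot_mulmxr Msym dotC.
have Lam_dot_sym : dot (wd x) (Lam *m w x) = dot (w x) (Lam *m wd x).
  by rewrite dot_mulmxr Lam_sym dotC.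
have regressor_adj : dot (w x) ((Y x)^T *m s x) = dot (s x) (Y x *m w x).
  by rewrite dot_mulmxr trmxK dotC.
rewrite inertia_sym Lam_dot_sym dotDr inertia_rate sdE wdE dotNr regressor_adj.
by rewrite dotBr dotDr dotNr; field.
Qed.

End adaptive_energy.

(** * The closed-loop system *)

Section columns.
Context {R : realType}.

Definition cols m n (f : 'I_n -> 'cV[R]_m) : 'M[R]_(m, n) := \matrix_(r, c) f c r ord0.

Lemma col_cols m n (f : 'I_n -> 'cV[R]_m) i : col i (cols f) = f i.
Proof. by apply/matrixP => r c; rewrite !mxE (ord1 c). Qed.

Lemma cvg_cols (T : Type) (F : set_system T) {FF : Filter F} m n
    (f : T -> 'I_n -> 'cV[R]_m) (a : 'I_n -> 'cV[R]_m) :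
  (forall i, f x i @[x --> F] --> a i) -> cols (f x) @[x --> F] --> cols a.
Proof.
move=> fa; apply/cvg_colP => i; rewrite col_cols.
by under eq_fun do rewrite col_cols; exact: fa.
Qed.

End columns.

Section closed_loop_system.
Context {R : realType} (N n p l : nat)
  (M : 'I_N -> 'cV[R]_n -> 'M[R]_n)
  (Cm : 'I_N -> 'cV[R]_n -> 'cV[R]_n -> 'M[R]_n)
  (G : 'I_N -> 'cV[R]_n -> 'cV[R]_n)
  (Y : 'I_N -> 'cV[R]_n -> 'cV[R]_n -> 'cV[R]_n -> 'cV[R]_n -> 'M[R]_(n, p))
  (Cout : 'M[R]_(n, l * 2)) (om0 : 'cV[R]_l) (E : rel 'I_N.+1)
  (alpha mu1 mu2 : R) (K : 'I_N -> 'M[R]_n) (Lam : 'I_N -> 'M[R]_p).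

(* The variables of the agents are stored as the columns of matrices, which form normed spaces. *)
Definition state : normedModType R :=
  ('cV[R]_(l * 2) * 'M[R]_(n, N) * 'M[R]_(n, N) * 'M[R]_(l * 2, N) * 'M[R]_(l, N) *
   'M[R]_(p, N))%type.

Implicit Types (x : state) (i : 'I_N).

Definition leader x : 'cV[R]_(l * 2) := x.1.1.1.1.1.
Definition position i x : 'cV[R]_n := col i x.1.1.1.1.2.
Definition velocity i x : 'cV[R]_n := col i x.1.1.1.2.
Definition observer i x : 'cV[R]_(l * 2) := col i x.1.1.2.
Definition frequency i x : 'cV[R]_l := col i x.1.2.
Definition parameter i x : 'cV[R]_p := col i x.2.

Definition mk_state v q qd eta om th : state :=
  (v, cols q, cols qd, cols eta, cols om, cols th).

Lemma mk_stateE v q qd eta om th i (x := mk_state v q qd eta om th) :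
  [/\ position i x = q i, velocity i x = qd i, observer i x = eta i, frequency i x = om i
    & parameter i x = th i].
Proof. by split; exact: col_cols. Qed.

Lemma cvg_stateP (T : Type) (F : set_system T) {FF : Filter F} (X : T -> state) x :
  X t @[t --> F] --> x <->
  (leader (X t) @[t --> F] --> leader x) /\
  forall i, [/\ position i (X t) @[t --> F] --> position i x,
    velocity i (X t) @[t --> F] --> velocity i x, observer i (X t) @[t --> F] --> observer i x,
    frequency i (X t) @[t --> F] --> frequency i x
    & parameter i (X t) @[t --> F] --> parameter i x].
Proof.
split=> [/cvg_pairP[/cvg_pairP[/cvg_pairP[/cvg_pairP[/cvg_pairP[Xv
    /cvg_colP Xq] /cvg_colP Xqd] /cvg_colP Xeta] /cvg_colP Xom] /cvg_colP Xth]|[Xv Xi]].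
  by split=> // i; split; [exact: Xq|exact: Xqd|exact: Xeta|exact: Xom|exact: Xth].
by do 5?[apply/cvg_pairP; split]; try (apply/cvg_colP => i; have [] := Xi i).
Qed.

Lemma is_derive_stateP (X : R -> state) (t : R) (dX : state) :
  is_derive t 1 X dX <->
  is_derive t 1 (leader \o X) (leader dX) /\
  forall i, [/\ is_derive t 1 (position i \o X) (position i dX),
    is_derive t 1 (velocity i \o X) (velocity i dX),
    is_derive t 1 (observer i \o X) (observer i dX),
    is_derive t 1 (frequency i \o X) (frequency i dX)
    & is_derive t 1 (parameter i \o X) (parameter i dX)].
Proof.
split=> [/is_derive_pairP[/is_derive_pairP[/is_derive_pairP[/is_derive_pairP[/is_derive_pairP[Xv
    /is_derive_colP Xq] /is_derive_colP Xqd] /is_derive_colP Xeta] /is_derive_colP Xom]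
    /is_derive_colP Xth]|[Xv Xi]].
  by split=> // i; split; [exact: Xq|exact: Xqd|exact: Xeta|exact: Xom|exact: Xth].
by do 5?[apply/is_derive_pairP; split]; try (apply/is_derive_colP => i; have [] := Xi i).
Qed.

Lemma bounded_on_stateP (T : Type) (A : set T) (X : T -> state) :
  bounded_on A X <->
  bounded_on A (leader \o X) /\
  forall i, [/\ bounded_on A (position i \o X), bounded_on A (velocity i \o X),
    bounded_on A (observer i \o X), bounded_on A (frequency i \o X)
    & bounded_on A (parameter i \o X)].
Proof.
split=> [/bounded_on_pairP[/bounded_on_pairP[/bounded_on_pairP[/bounded_on_pairP[
    /bounded_on_pairP[Xv /bounded_on_colP Xq] /bounded_on_colP Xqd] /bounded_on_colP Xeta]
    /bounded_on_colP Xom] /bounded_on_colP Xth]|[Xv Xi]].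
  by split=> // i; split; [exact: Xq|exact: Xqd|exact: Xeta|exact: Xom|exact: Xth].
by do 5?[apply/bounded_on_pairP; split]; try (apply/bounded_on_colP => i; have [] := Xi i).
Qed.

Lemma proper_state : proper_space state.
Proof.
by do 5?[apply: proper_space_prod; last exact: proper_space_mx]; exact: proper_space_mx.
Qed.

Definition consensus_error i x := disagreement E (leader x) (observer ^~ x) i.
Definition observer_rate i x := Smat (frequency i x) *m observer i x + mu1 *: consensus_error i x.
Definition frequency_rate i x := mu2 *: (phi (consensus_error i x) *m observer i x).
Definition tracking_error i x := position i x - Cout *m observer i x.
Definition reference_velocity i x :=
  Cout *m Smat (frequency i x) *m observer i x - alpha *: tracking_error i x.
Definition sliding_error i x := velocity i x - reference_velocity i x.
Definition reference_acceleration i x :=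
  Cout *m Smat (frequency i x) *m observer_rate i x +
  Cout *m Smat (frequency_rate i x) *m observer i x -
  alpha *: (velocity i x - Cout *m observer_rate i x).
Definition regressor i x :=
  Y i (position i x) (velocity i x) (reference_acceleration i x) (reference_velocity i x).
Definition coriolis i x := Cm i (position i x) (velocity i x).
Definition torque i x := - (K i *m sliding_error i x) + regressor i x *m parameter i x.
Definition acceleration i x := invmx (M i (position i x)) *m
  (torque i x - coriolis i x *m velocity i x - G i (position i x)).
Definition parameter_rate i x := - (invmx (Lam i) *m ((regressor i x)^T *m sliding_error i x)).

Definition dynamics x : state :=
  mk_state (Smat om0 *m leader x) (velocity ^~ x) (acceleration ^~ x) (observer_rate ^~ x)
    (frequency_rate ^~ x) (parameter_rate ^~ x).

Lemma continuous_leader : continuous leader.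
Proof. by move=> x; have [] := (cvg_stateP _ _).1 (@cvg_id _ (nbhs x)). Qed.

Lemma continuous_position i : continuous (position i).
Proof. by move=> x; have [_ /(_ i)[]] := (cvg_stateP _ _).1 (@cvg_id _ (nbhs x)). Qed.

Lemma continuous_velocity i : continuous (velocity i).
Proof. by move=> x; have [_ /(_ i)[]] := (cvg_stateP _ _).1 (@cvg_id _ (nbhs x)). Qed.

Lemma continuous_observer i : continuous (observer i).
Proof. by move=> x; have [_ /(_ i)[]] := (cvg_stateP _ _).1 (@cvg_id _ (nbhs x)). Qed.

Lemma continuous_frequency i : continuous (frequency i).
Proof. by move=> x; have [_ /(_ i)[]] := (cvg_stateP _ _).1 (@cvg_id _ (nbhs x)). Qed.

Lemma continuous_parameter i : continuous (parameter i).
Proof. by move=> x; have [_ /(_ i)[]] := (cvg_stateP _ _).1 (@cvg_id _ (nbhs x)). Qed.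

Lemma continuous_consensus_error i : continuous (consensus_error i).
Proof.
move=> x; apply: cvg_sum => j; apply: cvgB; last exact: continuous_observer.
rewrite /nodeval; case: unlift => [k|]; [exact: continuous_observer|exact: continuous_leader].
Qed.

Lemma continuous_observer_rate i : continuous (observer_rate i).
Proof.
move=> x; apply: cvgD; last by apply: cvg_scaler_cst; exact: continuous_consensus_error.
by apply: cvg_mulmx; [apply: cvg_Smat; exact: continuous_frequency|exact: continuous_observer].
Qed.

Lemma continuous_frequency_rate i : continuous (frequency_rate i).
Proof.
move=> x; apply: cvg_scaler_cst; apply: cvg_mulmx; last exact: continuous_observer.
by apply: cvg_phi; exact: continuous_consensus_error.
Qed.

Lemma continuous_tracking_error i : continuous (tracking_error i).
Proof.
move=> x; apply: cvgB; first exact: continuous_position.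
by apply: cvg_mulmxr; exact: continuous_observer.
Qed.

Lemma continuous_reference_velocity i : continuous (reference_velocity i).
Proof.
move=> x; apply: cvgB; last by apply: cvg_scaler_cst; exact: continuous_tracking_error.
apply: cvg_mulmx; last exact: continuous_observer.
by apply: cvg_mulmxr; apply: cvg_Smat; exact: continuous_frequency.
Qed.

Lemma continuous_sliding_error i : continuous (sliding_error i).
Proof.
by move=> x; apply: cvgB; [exact: continuous_velocity|exact: continuous_reference_velocity].
Qed.

Lemma continuous_reference_acceleration i : continuous (reference_acceleration i).
Proof.
move=> x; apply: cvgB; last first.
  apply: cvg_scaler_cst; apply: cvgB; first exact: continuous_velocity.
  by apply: cvg_mulmxr; exact: continuous_observer_rate.
apply: cvgD; apply: cvg_mulmx.
- by apply: cvg_mulmxr; apply: cvg_Smat; exact: continuous_frequency.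
- exact: continuous_observer_rate.
- by apply: cvg_mulmxr; apply: cvg_Smat; exact: continuous_frequency_rate.
- exact: continuous_observer.
Qed.

Context (kM : 'I_N -> R).
Hypothesis Mdiff : forall i q, differentiable (M i) q.
Hypothesis Ccont : forall i, continuous (fun z : 'cV[R]_n * 'cV[R]_n => Cm i z.1 z.2).
Hypothesis Gcont : forall i, continuous (G i).
Hypothesis Ycont : forall i, continuous
  (fun z : 'cV[R]_n * 'cV[R]_n * 'cV[R]_n * 'cV[R]_n => Y i z.1.1.1 z.1.1.2 z.1.2 z.2).
Hypothesis kM_gt0 : forall i, 0 < kM i.
Hypothesis Mcoercive : forall i q, coercive_mx (kM i) (M i q).

Lemma unitmx_inertia i q : M i q \in unitmx.
Proof. exact: coercive_unitmx (kM_gt0 i) (Mcoercive i q). Qed.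

Lemma continuous_inertia i : continuous (M i \o position i).
Proof.
move=> x; apply: (cvg_comp _ _ (@continuous_position i x)).
exact: differentiable_continuous (Mdiff i _).
Qed.

Lemma continuous_regressor i : continuous (regressor i).
Proof.
move=> x.
have args_cvg : (position i y, velocity i y, reference_acceleration i y, reference_velocity i y)
    @[y --> x] -->
    (position i x, velocity i x, reference_acceleration i x, reference_velocity i x).
  apply/cvg_pairP; split; last exact: continuous_reference_velocity.
  apply/cvg_pairP; split; last exact: continuous_reference_acceleration.
  by apply/cvg_pairP; split; [exact: continuous_position|exact: continuous_velocity].
exact: (cvg_comp _ _ args_cvg (@Ycont i _)).
Qed.

Lemma continuous_coriolis i : continuous (coriolis i).
Proof.
move=> x.
have args_cvg : (position i y, velocity i y) @[y --> x] --> (position i x, velocity i x).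
  by apply/cvg_pairP; split; [exact: continuous_position|exact: continuous_velocity].
exact: (cvg_comp _ _ args_cvg (@Ccont i _)).
Qed.

Lemma continuous_acceleration i : continuous (acceleration i).
Proof.
move=> x; apply: cvg_mulmx.
  by apply: cvg_invmx; [move=> y|idtac|exact: continuous_inertia]; exact: unitmx_inertia.
apply: cvgB; last by apply: (cvg_comp _ _ (@continuous_position i x)); exact: Gcont.
apply: cvgB; last first.
  by apply: cvg_mulmx; [exact: continuous_coriolis|exact: continuous_velocity].
apply: cvgD; first by apply: cvgN; apply: cvg_mulmxr; exact: continuous_sliding_error.
by apply: cvg_mulmx; [exact: continuous_regressor|exact: continuous_parameter].
Qed.

Lemma continuous_parameter_rate i : continuous (parameter_rate i).
Proof.
move=> x; apply: cvgN; apply: cvg_mulmxr.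
apply: cvg_mulmx; last exact: continuous_sliding_error.
by apply: cvg_trmx; exact: continuous_regressor.
Qed.

Lemma continuous_dynamics : continuous dynamics.
Proof.
move=> x; do 5?[apply/cvg_pairP; split].
- by apply: cvg_mulmxr; exact: continuous_leader.
- by apply: cvg_cols => i; exact: continuous_velocity.
- by apply: cvg_cols => i; exact: continuous_acceleration.
- by apply: cvg_cols => i; exact: continuous_observer_rate.
- by apply: cvg_cols => i; exact: continuous_frequency_rate.
- by apply: cvg_cols => i; exact: continuous_parameter_rate.
Qed.

Lemma closed_loopP (X : R -> state) :
  closed_loop M Cm G Y Cout om0 E alpha mu1 mu2 K Lam (leader \o X)
    (fun i => position i \o X) (fun i => velocity i \o X) (fun i => observer i \o X)
    (fun i => frequency i \o X) (fun i => parameter i \o X) <->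
  trajectory X (dynamics \o X).
Proof.
have dynamicsE i x := mk_stateE (Smat om0 *m leader x) (velocity ^~ x) (acceleration ^~ x)
  (observer_rate ^~ x) (frequency_rate ^~ x) (parameter_rate ^~ x) i.
have equation_of_motion i x acc :
    M i (position i x) *m acc + coriolis i x *m velocity i x + G i (position i x) = torque i x <->
    acc = acceleration i x.
  split=> [motion|->]; last by rewrite mulKVmx ?unitmx_inertia// addrAC !subrK.
  by rewrite /acceleration -motion addrAC !addrK mulKmx ?unitmx_inertia.
split=> [[Xv [Xi dX]]|[/cvg_stateP[Xv Xi] dX]].
  split; first by apply/cvg_stateP; split.
  move=> t /dX[dv di]; apply/is_derive_stateP; split=> // i.
  have [-> -> -> -> ->] := dynamicsE i (X t).
  by have [dq [acc [dqd /equation_of_motion <-]] deta dom dth] := di i.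
split=> //; split=> // t /dX/is_derive_stateP[dv di]; split=> // i.
have := di i; have [-> -> -> -> ->] := dynamicsE i (X t).
move=> [dq dqd deta dom dth]; split=> //; exists (acceleration i (X t)); split=> //.
exact/equation_of_motion.
Qed.

Lemma is_lie_leader : is_lie dynamics leader (fun x => Smat om0 *m leader x).
Proof.
exact: is_lie_fst (is_lie_fst (is_lie_fst (is_lie_fst (is_lie_fst
  (@is_lie_id _ _ dynamics))))).
Qed.

Lemma is_lie_position i : is_lie dynamics (position i) (velocity i).
Proof.
apply: (eq_is_lie _ _ (is_lie_col i (is_lie_snd (is_lie_fst (is_lie_fst (is_lie_fst
  (is_lie_fst (@is_lie_id _ _ dynamics)))))))) => x //.
exact: col_cols.
Qed.

Lemma is_lie_velocity i : is_lie dynamics (velocity i) (acceleration i).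
Proof.
apply: (eq_is_lie _ _ (is_lie_col i (is_lie_snd (is_lie_fst (is_lie_fst
  (is_lie_fst (@is_lie_id _ _ dynamics))))))) => x //.
exact: col_cols.
Qed.

Lemma is_lie_observer i : is_lie dynamics (observer i) (observer_rate i).
Proof.
apply: (eq_is_lie _ _ (is_lie_col i (is_lie_snd (is_lie_fst
  (is_lie_fst (@is_lie_id _ _ dynamics)))))) => x //.
exact: col_cols.
Qed.

Lemma is_lie_frequency i : is_lie dynamics (frequency i) (frequency_rate i).
Proof.
apply: (eq_is_lie _ _ (is_lie_col i (is_lie_snd (is_lie_fst (@is_lie_id _ _ dynamics))))) => x //.
exact: col_cols.
Qed.

Lemma is_lie_parameter i : is_lie dynamics (parameter i) (parameter_rate i).
Proof.
apply: (eq_is_lie _ _ (is_lie_col i (is_lie_snd (@is_lie_id _ _ dynamics)))) => x //.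
exact: col_cols.
Qed.

Definition tracking_error_rate i x :=
  sliding_error i x - alpha *: tracking_error i x - mu1 *: (Cout *m consensus_error i x).

Lemma is_lie_tracking_error i : is_lie dynamics (tracking_error i) (tracking_error_rate i).
Proof.
apply: (eq_is_lie _ _ (is_lieB (is_lie_position i) (is_lie_mulmxr Cout (is_lie_observer i)))).
  by [].
move=> x; rewrite /tracking_error_rate /sliding_error /reference_velocity /observer_rate.
by rewrite mulmxDr -scalemxAr mulmxA !opprD !opprK !addrA addrK.
Qed.

Lemma is_lie_reference_velocity i :
  is_lie dynamics (reference_velocity i) (reference_acceleration i).
Proof.
apply: (eq_is_lie _ _ (is_lieB
  (is_lie_mulmx (is_lie_mulmxr Cout (is_lie_Smat (is_lie_frequency i))) (is_lie_observer i))
  (is_lieZ alpha (is_lieB (is_lie_position i) (is_lie_mulmxr Cout (is_lie_observer i)))))).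
  by [].
by move=> x; rewrite [X in X - _]addrC.
Qed.

Lemma is_lie_sliding_error i : is_lie dynamics (sliding_error i)
  (fun x => acceleration i x - reference_acceleration i x).
Proof. exact: is_lieB (is_lie_velocity i) (is_lie_reference_velocity i). Qed.

Context (kK : 'I_N -> R) (kC : R) (Theta : 'I_N -> 'cV[R]_p).
Hypothesis Msym : forall i q, (M i q)^T = M i q.
Hypothesis Yparam : forall i q qd a b,
  M i q *m a + Cm i q qd *m b + G i q = Y i q qd a b *m Theta i.
Hypothesis Cskew : forall i q qd,
  ('d (M i) q qd - 2%:R *: Cm i q qd)^T = - ('d (M i) q qd - 2%:R *: Cm i q qd).
Hypothesis Etree : has_spanning_tree E ord0.
Hypothesis Eundirected : forall i j : 'I_N,
  E (lift ord0 i) (lift ord0 j) = E (lift ord0 j) (lift ord0 i).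
Hypotheses (alpha_gt0 : 0 < alpha) (mu1_gt0 : 0 < mu1) (mu2_gt0 : 0 < mu2).
Hypothesis kK_gt0 : forall i, 0 < kK i.
Hypothesis Kcoercive : forall i, coercive_mx (kK i) (K i).
Hypothesis Lam_posdef : forall i, posdef (Lam i).
Hypothesis kC_ge0 : 0 <= kC.
Hypothesis Cout_bound : forall y, dot (Cout *m y) (Cout *m y) <= kC * dot y y.

Definition parameter_error i x := parameter i x - Theta i.

Definition agent_energy i x :=
  adaptive_energy (M i (position i x)) (sliding_error i x) (Lam i) (parameter_error i x).

Definition network_energy x :=
  observer_energy E om0 mu2 (leader x) (observer ^~ x) (frequency ^~ x).

(* The weights make the cross terms of the derivative of [|tracking_error i x|^2 / 2]
   absorbable, by Young's inequality, in the dissipation of the energies. *)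
Definition agent_weight i := (alpha^-1 + 1) / kK i.
Definition network_weight := mu1 * kC / alpha + mu1^-1.

Definition agent_lyapunov i x :=
  2^-1 * dot (tracking_error i x) (tracking_error i x) + agent_weight i * agent_energy i x.

Definition lyapunov x := 2^-1 * dot (leader x) (leader x) +
  (network_weight * network_energy x + \sum_i agent_lyapunov i x).

Definition lyapunov_rate x :=
  network_weight * - (mu1 * \sum_i dot (consensus_error i x) (consensus_error i x)) +
  \sum_i (dot (tracking_error i x) (tracking_error_rate i x) +
    agent_weight i * - dot (sliding_error i x) (K i *m sliding_error i x)).

Definition dissipation i x := alpha / 2 * dot (tracking_error i x) (tracking_error i x) +
  dot (sliding_error i x) (sliding_error i x) + dot (consensus_error i x) (consensus_error i x).

Lemma agent_weight_gt0 i : 0 < agent_weight i.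
Proof. by rewrite divr_gt0// addr_gt0 ?invr_gt0. Qed.

Lemma network_weight_gt0 : 0 < network_weight.
Proof. by rewrite ltr_wpDl ?invr_gt0// divr_ge0 ?mulr_ge0// ltW. Qed.

Lemma sliding_error_dynamics i x :
  M i (position i x) *m (acceleration i x - reference_acceleration i x) =
  - (K i *m sliding_error i x) + regressor i x *m parameter_error i x -
  coriolis i x *m sliding_error i x.
Proof.
rewrite mulmxBr mulKVmx ?unitmx_inertia// [regressor i x *m _]mulmxBr -Yparam.
rewrite [coriolis i x *m sliding_error i x]mulmxBr /torque.
move: (K i *m _) (_ *m parameter i x) (_ *m velocity i x) (_ *m reference_velocity i x)
  (G i _) (M i _ *m _) => a b d e f g.
by apply/matrixP => r k; rewrite !mxE; ring.
Qed.

Lemma is_lie_agent_energy i : is_lie dynamics (agent_energy i)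
  (fun x => - dot (sliding_error i x) (K i *m sliding_error i x)).
Proof.
apply: (is_lie_adaptive_energy (Cm := coriolis i) (Y := regressor i) (Mdiff i) (Msym i)
  (Lam_posdef i).1 _ (is_lie_position i) (is_lie_sliding_error i)
  (is_lieBr (Theta i) (is_lie_parameter i))) => x.
- exact: Cskew.
- exact: sliding_error_dynamics.
- have [kL kL0 /(coercive_unitmx kL0) Lam_unit] := posdef_coercive (Lam_posdef i).
  by rewrite mulmxN mulKVmx.
Qed.

Lemma is_lie_network_energy : is_lie dynamics network_energy
  (fun x => - (mu1 * \sum_i dot (consensus_error i x) (consensus_error i x))).
Proof.
exact: (is_lie_observer_energy (eta := observer) (om := frequency) mu2_gt0 Eundirected
  is_lie_leader is_lie_observer is_lie_frequency).
Qed.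

Lemma is_lie_lyapunov : is_lie dynamics lyapunov lyapunov_rate.
Proof.
have agentP i := is_lieD (is_lie_sqdot (is_lie_tracking_error i))
  (is_lieMl (agent_weight i) (is_lie_agent_energy i)).
apply: (eq_is_lie _ _ (is_lieD (is_lie_sqdot is_lie_leader)
  (is_lieD (is_lieMl network_weight is_lie_network_energy) (is_lie_sum agentP)))) => x //.
by rewrite dot_skew ?add0r//; exact: Smat_skew.
Qed.

Lemma lyapunov_rate_le x : lyapunov_rate x <= - \sum_i dissipation i x.
Proof.
rewrite /lyapunov_rate mulr_sumr -sumrN mulr_sumr -big_split/= -sumrN.
apply: ler_sum => i _; rewrite /dissipation /tracking_error_rate.
set e := tracking_error i x; set s := sliding_error i x; set ev := consensus_error i x.
have a4 : 0 < alpha / 4 by rewrite divr_gt0.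
have a4E : (4 * (alpha / 4))^-1 = alpha^-1 by rewrite mulrC divfK.
have cross_sliding := dot_young e s a4.
have cross_consensus := dot_young e (- (mu1 *: (Cout *m ev))) a4.
rewrite a4E in cross_sliding cross_consensus.
rewrite !(dotNr, dotNl) opprK !(dotZr, dotZl) in cross_consensus.
have sliding_absorbed : (alpha^-1 + 1) * dot s s <= agent_weight i * dot s (K i *m s).
  rewrite /agent_weight -mulrA ler_wpM2l ?addr_ge0 ?invr_ge0 ?(ltW alpha_gt0)//.
  by rewrite mulrC ler_pdivlMr// mulrC; exact: Kcoercive.
have consensus_absorbed : alpha^-1 * (mu1 * (mu1 * dot (Cout *m ev) (Cout *m ev))) <=
    (network_weight * mu1 - 1) * dot ev ev.
  have -> : network_weight * mu1 - 1 = alpha^-1 * mu1 * mu1 * kC.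
    by rewrite /network_weight; field; rewrite !gt_eqF.
  by rewrite !mulrA -[leRHS]mulrA ler_wpM2l// !mulr_ge0 ?invr_ge0// ltW.
clearbody e s ev; rewrite !dotBr !dotZr.
by lra.
Qed.

Lemma dissipation_ge0 i x : 0 <= dissipation i x.
Proof. by rewrite !addr_ge0 ?mulr_ge0 ?dot_ge0 ?invr_ge0// ltW. Qed.

Lemma dissipation_le i x : dissipation i x <= - lyapunov_rate x.
Proof.
rewrite lerNr (le_trans (lyapunov_rate_le x))// lerN2.
exact: ler_sum_term i (dissipation_ge0 ^~ x).
Qed.

Lemma lyapunov_rate_le0 x : lyapunov_rate x <= 0.
Proof.
apply: le_trans (lyapunov_rate_le x) _; rewrite oppr_le0.
by apply: sumr_ge0 => i _; exact: dissipation_ge0.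
Qed.

Lemma continuous_network_energy : continuous network_energy.
Proof.
move=> x; apply: cvg_observer_energy; first exact: continuous_leader.
- by move=> i; exact: continuous_observer.
- by move=> i; exact: continuous_frequency.
Qed.

Lemma continuous_agent_energy i : continuous (agent_energy i).
Proof.
move=> x; apply: cvg_adaptive_energy; first exact: continuous_inertia.
  exact: continuous_sliding_error.
by apply: cvgB; [exact: continuous_parameter|exact: cvg_cst].
Qed.

Lemma continuous_lyapunov : continuous lyapunov.
Proof.
move=> x; apply: cvgD.
  by apply: cvgM; [exact: cvg_cst|apply: cvg_dot; exact: continuous_leader].
apply: cvgD; first by apply: cvgM; [exact: cvg_cst|exact: continuous_network_energy].
apply: cvg_sum => i; apply: cvgD; apply: cvgM; try exact: cvg_cst.
  by apply: cvg_dot; exact: continuous_tracking_error.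
exact: continuous_agent_energy.
Qed.

Lemma continuous_lyapunov_rate : continuous lyapunov_rate.
Proof.
move=> x; apply: cvgD.
  apply: cvgM; first exact: cvg_cst.
  apply: cvgN; apply: cvgM; first exact: cvg_cst.
  by apply: cvg_sum => i; apply: cvg_dot; exact: continuous_consensus_error.
apply: cvg_sum => i; apply: cvgD.
  apply: cvg_dot; first exact: continuous_tracking_error.
  apply: cvgB; last by apply: cvg_scaler_cst; apply: cvg_mulmxr; exact: continuous_consensus_error.
  apply: cvgB; first exact: continuous_sliding_error.
  by apply: cvg_scaler_cst; exact: continuous_tracking_error.
apply: cvgM; first exact: cvg_cst.
apply: cvgN; apply: cvg_dot; first exact: continuous_sliding_error.
by apply: cvg_mulmxr; exact: continuous_sliding_error.
Qed.

Lemma agent_energy_ge i : exists2 kL : R, 0 < kL & forall x,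
  kM i * dot (sliding_error i x) (sliding_error i x) +
  kL * dot (parameter_error i x) (parameter_error i x) <= 2 * agent_energy i x.
Proof.
have [kL kL0 Lam_coercive] := posdef_coercive (Lam_posdef i); exists kL => // x.
rewrite -ler_pdivrMl//; apply: adaptive_energy_ge Lam_coercive.
exact: Mcoercive.
Qed.

Lemma agent_energy_ge0 i x : 0 <= agent_energy i x.
Proof.
have [kL /ltW kL0 /(_ x) energy_ge] := agent_energy_ge i.
rewrite -(pmulr_rge0 _ (ltr0n _ 2)); apply: le_trans energy_ge.
by rewrite addr_ge0 ?mulr_ge0 ?dot_ge0// ltW.
Qed.

Lemma agent_lyapunov_ge0 i x : 0 <= agent_lyapunov i x.
Proof.
apply: addr_ge0; first by rewrite mulr_ge0 ?invr_ge0 ?dot_ge0.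
by rewrite mulr_ge0 ?agent_energy_ge0 ?(ltW (agent_weight_gt0 i)).
Qed.

Lemma weighted_network_energy_ge0 x : 0 <= network_weight * network_energy x.
Proof. by rewrite mulr_ge0 ?observer_energy_ge0 ?(ltW network_weight_gt0). Qed.

Lemma leader_energy_ge0 x : 0 <= 2^-1 * dot (leader x) (leader x).
Proof. by rewrite mulr_ge0 ?invr_ge0 ?dot_ge0. Qed.

Lemma sum_agent_lyapunov_ge0 x : 0 <= \sum_i agent_lyapunov i x.
Proof. by apply: sumr_ge0 => i _; exact: agent_lyapunov_ge0. Qed.

Lemma lyapunov_ge0 x : 0 <= lyapunov x.
Proof.
by rewrite !addr_ge0 ?leader_energy_ge0 ?weighted_network_energy_ge0 ?sum_agent_lyapunov_ge0.
Qed.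

Lemma sqdot_leader_le_lyapunov x : dot (leader x) (leader x) <= 2 * lyapunov x.
Proof.
rewrite -ler_pdivrMl// lerDl addr_ge0 ?weighted_network_energy_ge0//.
exact: sum_agent_lyapunov_ge0.
Qed.

Lemma network_energy_le_lyapunov x : network_energy x <= lyapunov x / network_weight.
Proof.
rewrite ler_pdivlMr ?network_weight_gt0// mulrC.
have := leader_energy_ge0 x; have := sum_agent_lyapunov_ge0 x; rewrite /lyapunov.
by lra.
Qed.

Lemma agent_lyapunov_le_lyapunov i x : agent_lyapunov i x <= lyapunov x.
Proof.
have := ler_sum_term i (agent_lyapunov_ge0 ^~ x).
have := leader_energy_ge0 x; have := weighted_network_energy_ge0 x; rewrite /lyapunov.
by lra.
Qed.

Lemma sqdot_tracking_error_le_lyapunov i x :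
  dot (tracking_error i x) (tracking_error i x) <= 2 * lyapunov x.
Proof.
rewrite -ler_pdivrMl//; apply: le_trans (agent_lyapunov_le_lyapunov i x).
by rewrite lerDl mulr_ge0 ?agent_energy_ge0 ?(ltW (agent_weight_gt0 i)).
Qed.

Lemma agent_energy_le_lyapunov i x : agent_energy i x <= lyapunov x / agent_weight i.
Proof.
rewrite ler_pdivlMr ?agent_weight_gt0// mulrC.
apply: le_trans (agent_lyapunov_le_lyapunov i x).
by rewrite lerDr mulr_ge0 ?invr_ge0 ?dot_ge0.
Qed.

Section sublevel_sets.
Context (u : R).
Let A : set state := [set x | lyapunov x <= u].

Lemma sublevel_leader : bounded_on A leader.
Proof.
apply: (@bounded_on_sqdot _ _ _ _ _ (2 * u)) => x /= xu.
by apply: le_trans (sqdot_leader_le_lyapunov x) _; rewrite ler_pM2l.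
Qed.

Lemma sublevel_network_energy x : A x -> network_energy x <= u / network_weight.
Proof.
move=> xu; apply: le_trans (network_energy_le_lyapunov x) _.
by rewrite ler_wpM2r ?invr_ge0 ?(ltW network_weight_gt0).
Qed.

Lemma sublevel_agent_energy i x : A x -> 2 * agent_energy i x <= 2 * (u / agent_weight i).
Proof.
move=> xu; rewrite ler_pM2l//; apply: le_trans (agent_energy_le_lyapunov i x) _.
by rewrite ler_wpM2r ?invr_ge0 ?(ltW (agent_weight_gt0 i)).
Qed.

Lemma sublevel_observer i : bounded_on A (observer i).
Proof.
have error_bounded : bounded_on A (fun x => observer i x - leader x).
  exists (N.+1%:R * Num.sqrt (2 * (2 * (u / network_weight)))) => x xu.
  apply: le_trans (dirichlet_bound Etree (leader x) (observer ^~ x) i) _.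
  rewrite ler_wpM2l// ler_wsqrtr// ler_pM2l//.
  apply: le_trans (dirichlet_le_observer_energy E om0 mu2_gt0 _ _ (frequency ^~ x)) _.
  by rewrite ler_pM2l// sublevel_network_energy.
apply: eq_bounded_on (bounded_onD error_bounded sublevel_leader) => x.
by rewrite subrK.
Qed.

Lemma sublevel_frequency i : bounded_on A (frequency i).
Proof.
apply: (@bounded_onBr _ _ _ _ _ om0).
apply: (@bounded_on_sqdot _ _ _ _ _ (2 * mu2 * (u / network_weight))) => x xu.
apply: le_trans (frequency_le_observer_energy E om0 mu2_gt0 (leader x) (observer ^~ x)
  (frequency ^~ x) i) _.
by rewrite ler_pM2l ?mulr_gt0// sublevel_network_energy.
Qed.

Lemma sublevel_tracking_error i : bounded_on A (tracking_error i).
Proof.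
apply: (@bounded_on_sqdot _ _ _ _ _ (2 * u)) => x /= xu.
by apply: le_trans (sqdot_tracking_error_le_lyapunov i x) _; rewrite ler_pM2l.
Qed.

Lemma sublevel_sliding_error i : bounded_on A (sliding_error i).
Proof.
have [kL /ltW kL0 energy_ge] := agent_energy_ge i.
apply: (@bounded_on_sqdot _ _ _ _ _ (2 * (u / agent_weight i) / kM i)) => x xu.
rewrite ler_pdivlMr// mulrC; apply: le_trans (sublevel_agent_energy i xu).
by apply: le_trans (energy_ge x); rewrite lerDl mulr_ge0 ?dot_ge0.
Qed.

Lemma sublevel_parameter i : bounded_on A (parameter i).
Proof.
have [kL kL0 energy_ge] := agent_energy_ge i.
apply: (@bounded_onBr _ _ _ _ _ (Theta i)).
apply: (@bounded_on_sqdot _ _ _ _ _ (2 * (u / agent_weight i) / kL)) => x xu.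
rewrite ler_pdivlMr// mulrC; apply: le_trans (sublevel_agent_energy i xu).
by apply: le_trans (energy_ge x); rewrite lerDr mulr_ge0 ?dot_ge0 ?(ltW (kM_gt0 i)).
Qed.

Lemma sublevel_position i : bounded_on A (position i).
Proof.
have Cobserver_bounded := bounded_on_mulmx (bounded_on_cst A Cout) (sublevel_observer i).
apply: eq_bounded_on (bounded_onD (sublevel_tracking_error i) Cobserver_bounded) => x.
by rewrite subrK.
Qed.

Lemma sublevel_velocity i : bounded_on A (velocity i).
Proof.
have Smat_bounded : bounded_on A (fun x => Smat (frequency i x)).
  have [B omB] := sublevel_frequency i; exists B => x xu.
  exact: le_trans (norm_Smat_le _) (omB x xu).
have reference_bounded : bounded_on A (reference_velocity i).
  apply: bounded_onB; last by apply: bounded_onZ; exact: sublevel_tracking_error.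
  apply: bounded_on_mulmx (sublevel_observer i).
  exact: bounded_on_mulmx (bounded_on_cst A Cout) Smat_bounded.
apply: eq_bounded_on (bounded_onD (sublevel_sliding_error i) reference_bounded) => x.
by rewrite subrK.
Qed.

Lemma lyapunov_coercive : bounded_on A id.
Proof.
apply/bounded_on_stateP; split=> [|i]; first exact: sublevel_leader.
split; [exact: sublevel_position|exact: sublevel_velocity|exact: sublevel_observer|
  exact: sublevel_frequency|exact: sublevel_parameter].
Qed.

End sublevel_sets.

Lemma closed_loop_solution_exists v0 (q0 qd0 : 'I_N -> 'cV[R]_n) eta0 om1 th0 :
  exists v q qd eta om th,
    closed_loop M Cm G Y Cout om0 E alpha mu1 mu2 K Lam v q qd eta om th /\
    v 0 = v0 /\
    forall i, [/\ q i 0 = q0 i, qd i 0 = qd0 i, eta i 0 = eta0 i,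
                  om i 0 = om1 i & th i 0 = th0 i].
Proof.
have [X X0 Xsol] := lyapunov_global_solution proper_state continuous_dynamics continuous_lyapunov
  is_lie_lyapunov lyapunov_rate_le0 lyapunov_coercive (mk_state v0 q0 qd0 eta0 om1 th0).
exists (leader \o X), (fun i => position i \o X), (fun i => velocity i \o X),
  (fun i => observer i \o X), (fun i => frequency i \o X), (fun i => parameter i \o X).
split; first exact/closed_loopP.
by rewrite /= X0; split=> // i; exact: mk_stateE.
Qed.

Section convergence.
Context (X : R -> state).
Hypothesis Xsol : trajectory X (dynamics \o X).

Lemma solution_bounded : bounded_on [set t : R | 0 <= t] X.
Proof.
exact: (lyapunov_bounded continuous_lyapunov is_lie_lyapunov lyapunov_rate_le0
  lyapunov_coercive Xsol).
Qed.

Lemma dissipation_cvg0 i : dissipation i (X t) @[t --> +oo] --> 0.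
Proof.
apply: (squeeze_cvgr (f := fun=> 0) (h := fun t => - lyapunov_rate (X t))).
- by apply: nearW => t; rewrite dissipation_ge0 dissipation_le.
- exact: cvg_cst.
rewrite -[X in _ --> X]oppr0; apply: cvgN.
exact: (lyapunov_derivative_cvg0 proper_state continuous_dynamics continuous_lyapunov
  continuous_lyapunov_rate is_lie_lyapunov lyapunov_ge0 lyapunov_rate_le0 lyapunov_coercive).
Qed.

Lemma cvg0_dissipated m (f : state -> 'cV[R]_m) i (k : R) : 0 < k ->
  (forall x, k * dot (f x) (f x) <= dissipation i x) ->
  f (X t) @[t --> +oo] --> (0 : 'cV[R]_m).
Proof.
move=> k0 f_le; apply: cvg0_sqdot.
apply: (squeeze_cvgr (f := fun=> 0) (h := fun t => k^-1 * dissipation i (X t))).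
- by apply: nearW => t; rewrite dot_ge0/= ler_pdivlMl.
- exact: cvg_cst.
- rewrite -[X in _ --> X](mulr0 k^-1); apply: cvgM; first exact: cvg_cst.
  exact: dissipation_cvg0.
Qed.

Lemma tracking_error_cvg0 i : tracking_error i (X t) @[t --> +oo] --> (0 : 'cV[R]_n).
Proof.
apply: (@cvg0_dissipated _ _ i (alpha / 2)) => [|x]; first by rewrite divr_gt0.
by rewrite /dissipation -addrA lerDl addr_ge0 ?dot_ge0.
Qed.

Lemma sliding_error_cvg0 i : sliding_error i (X t) @[t --> +oo] --> (0 : 'cV[R]_n).
Proof.
apply: (@cvg0_dissipated _ _ i 1) => // x; rewrite mul1r /dissipation addrAC lerDr.
by rewrite addr_ge0 ?mulr_ge0 ?dot_ge0 ?divr_ge0// ltW.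
Qed.

Lemma consensus_error_cvg0 i : consensus_error i (X t) @[t --> +oo] --> (0 : 'cV[R]_(l * 2)).
Proof.
apply: (@cvg0_dissipated _ _ i 1) => // x; rewrite mul1r lerDr.
by rewrite addr_ge0 ?mulr_ge0 ?dot_ge0 ?divr_ge0// ltW.
Qed.

Lemma observer_error_cvg0 i :
  observer i (X t) - leader (X t) @[t --> +oo] --> (0 : 'cV[R]_(l * 2)).
Proof.
have [v_bounded components_bounded] := (bounded_on_stateP _ _).1 solution_bounded.
have error_bounded j : bounded_on [set t : R | 0 <= t]
    (fun t => observer j (X t) - leader (X t)).
  by have [_ _ eta_bounded _ _] := components_bounded j; exact: bounded_onB eta_bounded v_bounded.
have [B errB] := choice error_bounded.
apply: (@disagreement_cvg0 _ _ _ E Eundirected Etree _ _ _ (leader \o X)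
  (fun i => observer i \o X) (\sum_j `|B j|) _ _ i) => j; first exact: consensus_error_cvg0.
near=> t; apply: le_trans (errB j t _) _; first by rewrite /=.
apply: le_trans (ler_norm _) _.
by apply: (@ler_sum_term _ _ (fun j => `|B j|)).
Unshelve. all: by end_near. Qed.

Lemma observer_rate_error_cvg0 i :
  observer_rate i (X t) - Smat om0 *m leader (X t) @[t --> +oo] --> (0 : 'cV[R]_(l * 2)).
Proof.
apply: (bounded_solution_barbalat proper_state continuous_dynamics
  (f := fun x => observer i x - leader x) (df := fun x => observer_rate i x - Smat om0 *m leader x)
  Xsol solution_bounded _ _ (is_lieB (is_lie_observer i) is_lie_leader) (observer_error_cvg0 i)).
  by move=> x; apply: cvgB; [exact: continuous_observer|exact: continuous_leader].
move=> x; apply: cvgB; first exact: continuous_observer_rate.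
by apply: cvg_mulmxr; exact: continuous_leader.
Qed.

Lemma position_tracking i : position i (X t) - Cout *m leader (X t) @[t --> +oo] --> (0 : 'cV[R]_n).
Proof.
have -> : (fun t => position i (X t) - Cout *m leader (X t)) =
    (fun t => tracking_error i (X t) + Cout *m (observer i (X t) - leader (X t))).
  by apply/funext => t; rewrite /tracking_error mulmxBr addrA subrK.
have -> : (0 : 'cV[R]_n) = 0 + Cout *m 0 by rewrite mulmx0 addr0.
by apply: cvgD; [exact: tracking_error_cvg0|apply: cvg_mulmxr; exact: observer_error_cvg0].
Qed.

Lemma velocity_tracking i :
  velocity i (X t) - Cout *m (Smat om0 *m leader (X t)) @[t --> +oo] --> (0 : 'cV[R]_n).
Proof.
have -> : (fun t => velocity i (X t) - Cout *m (Smat om0 *m leader (X t))) =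
    (fun t => sliding_error i (X t) - alpha *: tracking_error i (X t) +
      Cout *m (observer_rate i (X t) - Smat om0 *m leader (X t) - mu1 *: consensus_error i (X t))).
  apply/funext => t.
  have -> : observer_rate i (X t) - Smat om0 *m leader (X t) - mu1 *: consensus_error i (X t) =
      Smat (frequency i (X t)) *m observer i (X t) - Smat om0 *m leader (X t).
    by rewrite /observer_rate addrAC addrK.
  rewrite /sliding_error /reference_velocity opprB mulmxBr !mulmxA !addrA.
  by rewrite [X in X + _ - _]addrAC addrK subrK.
have -> : (0 : 'cV[R]_n) = 0 - alpha *: 0 + Cout *m (0 - mu1 *: 0).
  by rewrite !scaler0 !subr0 mulmx0 addr0.
apply: cvgD.
  apply: cvgB; first exact: sliding_error_cvg0.
  by apply: cvg_scaler_cst; exact: tracking_error_cvg0.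
apply: cvg_mulmxr; apply: cvgB; first exact: observer_rate_error_cvg0.
by apply: cvg_scaler_cst; exact: consensus_error_cvg0.
Qed.

End convergence.

Lemma closed_loop_tracking v q qd eta om th :
  closed_loop M Cm G Y Cout om0 E alpha mu1 mu2 K Lam v q qd eta om th ->
  forall i,
    [/\ bounded_pos (q i), bounded_pos (qd i), bounded_pos (eta i),
        bounded_pos (om i) & bounded_pos (th i)] /\
    (q i t - Cout *m v t @[t --> +oo] --> (0 : 'cV[R]_n)) /\
    (qd i t - Cout *m (Smat om0 *m v t) @[t --> +oo] --> (0 : 'cV[R]_n)).
Proof.
pose X t := mk_state (v t) (q ^~ t) (qd ^~ t) (eta ^~ t) (om ^~ t) (th ^~ t).
have XE i t := mk_stateE (v t) (q ^~ t) (qd ^~ t) (eta ^~ t) (om ^~ t) (th ^~ t) i.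
have -> : v = leader \o X by [].
have -> : q = fun i => position i \o X.
  by apply/funext => i; apply/funext => t; have [] := XE i t.
have -> : qd = fun i => velocity i \o X.
  by apply/funext => i; apply/funext => t; have [] := XE i t.
have -> : eta = fun i => observer i \o X.
  by apply/funext => i; apply/funext => t; have [] := XE i t.
have -> : om = fun i => frequency i \o X.
  by apply/funext => i; apply/funext => t; have [] := XE i t.
have -> : th = fun i => parameter i \o X.
  by apply/funext => i; apply/funext => t; have [] := XE i t.
move=> /closed_loopP Xsol i; have [_ /(_ i)] := (bounded_on_stateP _ _).1 (solution_bounded Xsol).
by split=> //; split; [exact: position_tracking|exact: velocity_tracking].
Qed.

End closed_loop_system.

Theorem theorem1 (R : realType) (N n p l : nat) (hl : (0 < l)%N)
  (M : 'I_N -> 'cV[R]_n -> 'M[R]_n)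
  (Cm : 'I_N -> 'cV[R]_n -> 'cV[R]_n -> 'M[R]_n)
  (G : 'I_N -> 'cV[R]_n -> 'cV[R]_n)
  (Y : 'I_N -> 'cV[R]_n -> 'cV[R]_n -> 'cV[R]_n -> 'cV[R]_n -> 'M[R]_(n, p))
  (Theta : 'I_N -> 'cV[R]_p)
  (Cout : 'M[R]_(n, l * 2)) (om0 : 'cV[R]_l) (E : rel 'I_N.+1)
  (alpha mu1 mu2 : R) (K : 'I_N -> 'M[R]_n) (Lam : 'I_N -> 'M[R]_p)
  (* regularity of the model (implicit in the paper) *)
  (hMd : forall i q, differentiable (M i) q)
  (hCc : forall i, continuous (fun z : 'cV[R]_n * 'cV[R]_n => Cm i z.1 z.2))
  (hGc : forall i, continuous (G i))
  (hYc : forall i, continuous (fun z : 'cV[R]_n * 'cV[R]_n * 'cV[R]_n * 'cV[R]_n =>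
                                  Y i z.1.1.1 z.1.1.2 z.1.2 z.2))
  (* (P1) *)
  (hP1s : forall i q, (M i q)^T = M i q)
  (hP1p : forall i, exists2 c : R, 0 < c &
            forall q (x : 'cV[R]_n), c * (x^T *m x) ord0 ord0 <= (x^T *m M i q *m x) ord0 ord0)
  (* (P2) *)
  (hP2 : forall i q qd a' b,
      M i q *m a' + Cm i q qd *m b + G i q = Y i q qd a' b *m Theta i)
  (* (P3) *)
  (hP3 : forall i q qd,
      ('d (M i) q qd - 2%:R *: Cm i q qd)^T = - ('d (M i) q qd - 2%:R *: Cm i q qd))
  (* leader *)
  (hom0 : forall k, 0 < om0 k ord0)
  (* graph *)
  (hE : has_spanning_tree E ord0)
  (hEu : forall i j : 'I_N, E (lift ord0 i) (lift ord0 j) = E (lift ord0 j) (lift ord0 i))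
  (* gains *)
  (halpha : 0 < alpha) (hmu1 : 0 < mu1) (hmu2 : 0 < mu2)
  (hK : forall i, posdef (K i))
  (hLd : forall i, is_diag_mx (Lam i)) (hLp : forall i k, 0 < Lam i k k) :
  (forall (v0 : 'cV[R]_(l * 2)) (q0 qd0 : 'I_N -> 'cV[R]_n)
          (eta0 : 'I_N -> 'cV[R]_(l * 2)) (omi0 : 'I_N -> 'cV[R]_l)
          (th0 : 'I_N -> 'cV[R]_p),
     exists v q qd eta om th,
       closed_loop M Cm G Y Cout om0 E alpha mu1 mu2 K Lam v q qd eta om th /\
       v 0 = v0 /\
       forall i, [/\ q i 0 = q0 i, qd i 0 = qd0 i, eta i 0 = eta0 i,
                     om i 0 = omi0 i & th i 0 = th0 i]) /\
  (forall v q qd eta om th,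
     closed_loop M Cm G Y Cout om0 E alpha mu1 mu2 K Lam v q qd eta om th ->
     forall i,
       [/\ bounded_pos (q i), bounded_pos (qd i), bounded_pos (eta i),
           bounded_pos (om i) & bounded_pos (th i)] /\
       (q i t - Cout *m v t @[t --> +oo] --> (0 : 'cV[R]_n)) /\
       (qd i t - Cout *m (Smat om0 *m v t) @[t --> +oo] --> (0 : 'cV[R]_n))).
Proof.
have Mpos i : exists kM : R, 0 < kM /\ forall q, coercive_mx kM (M i q).
  have [kM kM0 Mge] := hP1p i; exists kM; split=> // q x.
  by rewrite -!dotE mulmxA.
have Kpos i : exists kK : R, 0 < kK /\ coercive_mx kK (K i).
  by have [kK kK0 Kge] := posdef_coercive (hK i); exists kK.
have [kM /all_and2[kM0 Mge]] := choice Mpos; have [kK /all_and2[kK0 Kge]] := choice Kpos.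
have [kC kC0 Cbound] := dot_mulmx_bound Cout.
have Lam_posdef i := diag_posdef (hLd i) (hLp i).
split=> [v0 q0 qd0 eta0 omi0 th0|v q qd eta om th].
  exact: (closed_loop_solution_exists om0 hMd hCc hGc hYc kM0 Mge hP1s hP2 hP3 hE hEu halpha
    hmu1 hmu2 kK0 Kge Lam_posdef kC0 Cbound).
exact: (closed_loop_tracking hMd hCc hGc hYc kM0 Mge hP1s hP2 hP3 hE hEu halpha hmu1 hmu2 kK0
  Kge Lam_posdef kC0 Cbound).
Qed.
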